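(* For every integer $n \geq 5$ and every collection of non-trivial groups $\mathcal{G} = \{G_i \mid i \in \mathbb{Z}/n\mathbb{Z}\}$, the automorphism group of the cyclic product $C_n\mathcal{G}$ decomposes as $$\mathrm{Aut}(C_n\mathcal{G}) \simeq C_n\mathcal{G} \rtimes \left( \left( \prod_{i \in \mathbb{Z}/n\mathbb{Z}} \mathrm{Aut}(G_i) \right) \rtimes \mathrm{Sym} \right).$$
   Context: The cyclic product $C_n\mathcal{G}$ is the graph product of the groups $G_i$ over the cycle $C_n$ with vertex set $\mathbb{Z}/n\mathbb{Z}$ ($i$ adjacent to $i\pm 1$): the quotient of the free product $\ast_{i} G_i$ by the relations $gh=hg$ for all $g\in G_i$, $h\in G_{i+1}$, $i \in \mathbb{Z}/n\mathbb{Z}$. $\mathrm{Sym}$ is the group of graph automorphisms $\sigma$ of the cycle $C_n$ that preserve the isomorphism classes of the vertex-groups, i.e. $G_{\sigma(i)} \cong G_i$ for all $i$. The semi-direct products are the natural ones: fix isomorphisms $\theta_{i,j}: G_i \to G_j$ for all $i,j$ with $G_i\cong G_j$, such that $\theta_{i,i}=\mathrm{id}$ and $\theta_{j,k}\circ\theta_{i,j}=\theta_{i,k}$. An element $\sigma\in\mathrm{Sym}$ acts on $\prod_i \mathrm{Aut}(G_i)$ by $(\sigma\cdot\alpha)_{\sigma(i)} = \theta_{i,\sigma(i)}\circ\alpha_i\circ\theta_{i,\sigma(i)}^{-1}$, and a pair $(\alpha,\sigma)\in (\prod_i \mathrm{Aut}(G_i))\rtimes\mathrm{Sym}$ acts on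 $C_n\mathcal{G}$ as the automorphism sending $g\in G_i$ to $\alpha_{\sigma(i)}(\theta_{i,\sigma(i)}(g))\in G_{\sigma(i)}$. *)

(* Defs.v *)
From HB Require Import structures.
From mathcomp Require Import all_boot all_order all_algebra all_fingroup.
From mathcomp Require Import generic_quotient boolp.

Set Implicit Arguments.
Unset Strict Implicit.
Unset Printing Implicit Defensive.

Local Open Scope group_scope.

(* Groups are MathComp's groupType's, possibly infinite. The choiceType
   structure they carry is no restriction, as classically every type has one
   (boolp.gen_eqMixin, boolp.gen_choiceMixin). *)

Definition isomorphic (G H : groupType) : Prop :=
  exists f : {multiplicative G -> H}, bijective f.

(* Aut(G); the product is composition: (f * g) x = f (g x). *)
Section Automorphisms.
Variable G : groupType.

Record autgroup : Type := AutGroup {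
  aut_fun :> G -> G;
  autgroupP : `[< bijective aut_fun /\ {morph aut_fun : x y / x * y} >] }.

HB.instance Definition _ := [isSub for aut_fun].
HB.instance Definition _ := [Choice of autgroup by <:].

Lemma aut_bij (f : autgroup) : bijective f.
Proof. by case/asboolP: (autgroupP f). Qed.

Lemma autgroupM (f : autgroup) : {morph f : x y / x * y}.
Proof. by case/asboolP: (autgroupP f). Qed.

HB.instance Definition _ (f : autgroup) :=
  isMultiplicative.Build G G f (autgroupM f).

Lemma autgroup_ext (f g : autgroup) : f =1 g -> f = g.
Proof. by move=> fg; apply/val_inj/funext. Qed.

Lemma aut_one_subproof :
  `[< bijective (@id G) /\ {morph @id G : x y / x * y} >].
Proof. by apply/asboolP; split=> //; exists id. Qed.

Definition aut_one : autgroup := AutGroup aut_one_subproof.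

Lemma aut_mul_subproof (f g : autgroup) :
  `[< bijective (f \o g) /\ {morph f \o g : x y / x * y} >].
Proof.
apply/asboolP; split; first exact: bij_comp (aut_bij f) (aut_bij g).
by move=> x y /=; rewrite !autgroupM.
Qed.

Definition aut_mul (f g : autgroup) : autgroup :=
  AutGroup (aut_mul_subproof f g).

Lemma aut_inv_exists (f : autgroup) :
  exists h : autgroup, cancel f h /\ cancel h f.
Proof.
have [h fK hK] := aut_bij f.
suff hP : `[< bijective h /\ {morph h : x y / x * y} >].
  by exists (AutGroup hP).
apply/asboolP; split; first by exists f.
by move=> x y; apply: (can_inj fK); rewrite autgroupM !hK.
Qed.

Definition aut_inv (f : autgroup) : autgroup := sval (cid (aut_inv_exists f)).

Lemma aut_invK (f : autgroup) : cancel f (aut_inv f).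
Proof. by case: (svalP (cid (aut_inv_exists f))). Qed.

Lemma aut_invKV (f : autgroup) : cancel (aut_inv f) f.
Proof. by case: (svalP (cid (aut_inv_exists f))). Qed.

Lemma aut_mulA : associative aut_mul.
Proof. by move=> f g h; apply: autgroup_ext. Qed.
Lemma aut_mul1 : left_id aut_one aut_mul.
Proof. by move=> f; apply: autgroup_ext. Qed.
Lemma aut_1mul : right_id aut_one aut_mul.
Proof. by move=> f; apply: autgroup_ext. Qed.
Lemma aut_mulV : left_inverse aut_one aut_inv aut_mul.
Proof. by move=> f; apply: autgroup_ext; apply: aut_invK. Qed.
Lemma aut_Vmul : right_inverse aut_one aut_inv aut_mul.
Proof. by move=> f; apply: autgroup_ext; apply: aut_invKV. Qed.

HB.instance Definition _ :=
  isGroup.Build autgroup aut_mulA aut_mul1 aut_1mul aut_mulV aut_Vmul.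

End Automorphisms.

Section DirectProduct.
Variables (I : Type) (G : I -> groupType).

Definition group_prod : Type := forall i, G i.

HB.instance Definition _ := Choice.on group_prod.

Definition dp_one : group_prod := fun i => 1.
Definition dp_mul (x y : group_prod) : group_prod := fun i => x i * y i.
Definition dp_inv (x : group_prod) : group_prod := fun i => (x i)^-1.

Lemma dp_mulA : associative dp_mul.
Proof. by move=> x y z; apply/functional_extensionality_dep=> i; apply: mulgA. Qed.
Lemma dp_mul1 : left_id dp_one dp_mul.
Proof. by move=> x; apply/functional_extensionality_dep=> i; apply: mul1g. Qed.
Lemma dp_1mul : right_id dp_one dp_mul.
Proof. by move=> x; apply/functional_extensionality_dep=> i; apply: mulg1. Qed.
Lemma dp_mulV : left_inverse dp_one dp_inv dp_mul.
Proof. by move=> x; apply/functional_extensionality_dep=> i; apply: mulVg. Qed.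
Lemma dp_Vmul : right_inverse dp_one dp_inv dp_mul.
Proof. by move=> x; apply/functional_extensionality_dep=> i; apply: mulgV. Qed.

HB.instance Definition _ :=
  isGroup.Build group_prod dp_mulA dp_mul1 dp_1mul dp_mulV dp_Vmul.

End DirectProduct.

(* K >< H, for an action phi of H on K by automorphisms:
   (k, h) (k', h') = (k (phi h k'), h h'). *)
Definition semidirect (K H : groupType)
    (phi : {multiplicative H -> autgroup K}) : Type := (K * H)%type.

Section SemidirectProduct.
Variables (K H : groupType) (phi : {multiplicative H -> autgroup K}).

Local Notation S := (semidirect phi).

HB.instance Definition _ := Choice.on S.

Definition sd_one : S := (1, 1).
Definition sd_mul (x y : S) : S := (x.1 * phi x.2 y.1, x.2 * y.2).
Definition sd_inv (x : S) : S := (phi x.2^-1 x.1^-1, x.2^-1).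

Lemma sd_phi1 : phi 1 = 1.
Proof. by apply: (mulgI (phi 1)); rewrite -gmulfM !mulg1. Qed.

Lemma sd_aut1 (f : autgroup K) : f 1 = 1.
Proof. by apply: (mulgI (f 1)); rewrite -gmulfM !mulg1. Qed.

Lemma sd_mulA : associative sd_mul.
Proof.
move=> [k1 h1] [k2 h2] [k3 h3]; rewrite /sd_mul /= mulgA autgroupM mulgA.
by rewrite [phi (h1 * h2)]gmulfM.
Qed.
Lemma sd_mul1 : left_id sd_one sd_mul.
Proof. by move=> [k h]; rewrite /sd_mul /= sd_phi1 !mul1g. Qed.
Lemma sd_1mul : right_id sd_one sd_mul.
Proof. by move=> [k h]; rewrite /sd_mul /= sd_aut1 !mulg1. Qed.
Lemma sd_mulV : left_inverse sd_one sd_inv sd_mul.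
Proof. by move=> [k h]; rewrite /sd_mul /= -autgroupM !mulVg sd_aut1. Qed.
Lemma sd_Vmul : right_inverse sd_one sd_inv sd_mul.
Proof.
move=> [k h]; rewrite /sd_mul /=.
have -> : phi h (phi h^-1 k^-1) = (phi h * phi h^-1) k^-1 by [].
by rewrite -gmulfM mulgV sd_phi1 !mulgV.
Qed.

HB.instance Definition _ :=
  isGroup.Build S sd_mulA sd_mul1 sd_1mul sd_mulV sd_Vmul.

End SemidirectProduct.

(* The graph product of the groups G v over the graph (V, adj): the free
   product of the G v, as words modulo the congruence below, with gpc_comm
   imposing the commutation relations. *)
Section GraphProduct.
Variables (V : choiceType) (adj : rel V) (G : V -> groupType).

Definition letter := {v : V & G v}.
Definition word := seq letter.

Inductive gp_cong : word -> word -> Prop :=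
| gpc_refl w : gp_cong w w
| gpc_sym w1 w2 : gp_cong w1 w2 -> gp_cong w2 w1
| gpc_trans w1 w2 w3 : gp_cong w1 w2 -> gp_cong w2 w3 -> gp_cong w1 w3
| gpc_cat w1 w2 w3 w4 :
    gp_cong w1 w2 -> gp_cong w3 w4 -> gp_cong (w1 ++ w3) (w2 ++ w4)
| gpc_one v : gp_cong [:: Tagged G (1 : G v)] [::]
| gpc_mul v (g h : G v) :
    gp_cong [:: Tagged G g; Tagged G h] [:: Tagged G (g * h)]
| gpc_comm v w (g : G v) (h : G w) : adj v w ->
    gp_cong [:: Tagged G g; Tagged G h] [:: Tagged G h; Tagged G g].

Definition gp_congb : rel word := fun w1 w2 => `[< gp_cong w1 w2 >].

Lemma gp_congb_equiv : equiv_class_of gp_congb.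
Proof.
split=> [w | w1 w2 | w2 w1 w3].
- exact/asboolP/gpc_refl.
- by apply/asboolP/asboolP; apply: gpc_sym.
- by move=> /asboolP h12 /asboolP h23; apply/asboolP; apply: gpc_trans h23.
Qed.

Canonical gp_cong_equiv := EquivRelPack gp_congb_equiv.

Local Open Scope quotient_scope.

Definition graph_product := {eq_quot gp_cong_equiv}.
HB.instance Definition _ := Choice.on graph_product.
HB.instance Definition _ := EqQuotient.on graph_product.

Definition gprod_of_word (w : word) : graph_product := \pi_graph_product w.
Definition gprod_in v (g : G v) : graph_product :=
  gprod_of_word [:: Tagged G g].

Lemma gprod_of_wordP w1 w2 :
  gprod_of_word w1 = gprod_of_word w2 <-> gp_cong w1 w2.
Proof.
split=> [/eqmodP/asboolP //|h]; exact/eqmodP/asboolP.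
Qed.

Lemma gprod_repr (x : graph_product) : gprod_of_word (repr x) = x.
Proof. exact: reprK. Qed.

Lemma repr_gprod w : gp_cong (repr (gprod_of_word w)) w.
Proof. by apply/gprod_of_wordP; rewrite gprod_repr. Qed.

Definition gprod_one : graph_product := gprod_of_word [::].

Definition gprod_mul (x y : graph_product) : graph_product :=
  gprod_of_word (repr x ++ repr y).

Definition inv_word (w : word) : word :=
  rev [seq Tagged G (tagged l)^-1 | l : letter <- w].

Definition gprod_inv (x : graph_product) : graph_product :=
  gprod_of_word (inv_word (repr x)).

Lemma gprod_mulE w1 w2 :
  gprod_mul (gprod_of_word w1) (gprod_of_word w2) = gprod_of_word (w1 ++ w2).
Proof. by apply/gprod_of_wordP; apply: gpc_cat; apply: repr_gprod. Qed.

Lemma gprod_ind (P : graph_product -> Prop) :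
  (forall w, P (gprod_of_word w)) -> forall x, P x.
Proof. by move=> Pw x; rewrite -(gprod_repr x). Qed.

Lemma gprod_mulA : associative gprod_mul.
Proof.
move=> x y z; rewrite -(gprod_repr x) -(gprod_repr y) -(gprod_repr z).
by rewrite !gprod_mulE catA.
Qed.

Lemma gprod_mul1 : left_id gprod_one gprod_mul.
Proof. by move=> x; rewrite -(gprod_repr x) gprod_mulE. Qed.

Lemma gprod_1mul : right_id gprod_one gprod_mul.
Proof. by move=> x; rewrite -(gprod_repr x) gprod_mulE cats0. Qed.

Lemma gp_cong_cancel v (g h : G v) : g * h = 1 ->
  gp_cong [:: Tagged G g; Tagged G h] [::].
Proof.
by move=> gh; apply: gpc_trans (gpc_mul g h) _; rewrite gh; apply: gpc_one.
Qed.

Lemma inv_word_cons (l : letter) w :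
  inv_word (l :: w) = inv_word w ++ [:: Tagged G (tagged l)^-1].
Proof. by rewrite /inv_word map_cons rev_cons cats1. Qed.

Lemma gp_cong_invl w : gp_cong (inv_word w ++ w) [::].
Proof.
elim: w => [|[v g] w IHw]; first exact: gpc_refl.
rewrite inv_word_cons -catA /=.
apply: gpc_trans IHw; apply: gpc_cat; first exact: gpc_refl.
have := gpc_cat (gp_cong_cancel (mulVg g)) (gpc_refl w).
by [].
Qed.

Lemma gp_cong_invr w : gp_cong (w ++ inv_word w) [::].
Proof.
elim: w => [|[v g] w IHw]; first exact: gpc_refl.
rewrite inv_word_cons -cat1s -catA (catA w).
apply: gpc_trans (gp_cong_cancel (mulgV g)).
apply: (gpc_cat (gpc_refl [:: Tagged G g])).
exact: (gpc_cat IHw (gpc_refl _)).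
Qed.

Lemma gprod_mulV : left_inverse gprod_one gprod_inv gprod_mul.
Proof.
move=> x; rewrite -[x in X in gprod_mul _ X]gprod_repr gprod_mulE.
exact/gprod_of_wordP/gp_cong_invl.
Qed.

Lemma gprod_Vmul : right_inverse gprod_one gprod_inv gprod_mul.
Proof.
move=> x; rewrite -[x in X in gprod_mul X _]gprod_repr gprod_mulE.
exact/gprod_of_wordP/gp_cong_invr.
Qed.

HB.instance Definition _ := isGroup.Build graph_product
  gprod_mulA gprod_mul1 gprod_1mul gprod_mulV gprod_Vmul.

End GraphProduct.

(* The vertex set of the cycle is 'Z_n, which is Z/nZ as soon as n > 1. *)
Definition cycle_adj (n : nat) : rel 'Z_n :=
  fun i j => (j == i + 1)%R || (i == j + 1)%R.

Definition cyclic_product (n : nat) (G : 'Z_n -> groupType) :=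
  graph_product (@cycle_adj n) G.
HB.instance Definition _ n (G : 'Z_n -> groupType) :=
  Group.on (cyclic_product G).

Section CyclicProduct.
Variables (n : nat) (G : 'Z_n -> groupType).

Definition cycle_sym_pred (s : {perm 'Z_n}) : bool :=
  `[< (forall i j, cycle_adj (s i) (s j) = cycle_adj i j) /\
      (forall i, isomorphic (G (s i)) (G i)) >].

Record cycle_sym : Type := CycleSym {
  cycle_perm :> {perm 'Z_n};
  cycle_symP : cycle_sym_pred cycle_perm }.

HB.instance Definition _ := [isSub for cycle_perm].
HB.instance Definition _ := [Choice of cycle_sym by <:].

Lemma isomorphic_refl (A : groupType) : isomorphic A A.
Proof. by exists idfun; exists id. Qed.

Lemma isomorphic_sym (A B : groupType) : isomorphic A B -> isomorphic B A.
Proof.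
case=> f [g fK gK]; have gM : {morph g : x y / x * y}.
  by move=> x y; apply: (can_inj fK); rewrite gmulfM !gK.
pose g' : {multiplicative B -> A} :=
  HB.pack g (isMultiplicative.Build B A g gM).
by exists g'; exists f.
Qed.

Lemma isomorphic_trans (A B C : groupType) :
  isomorphic A B -> isomorphic B C -> isomorphic A C.
Proof. by case=> f bf [g bg]; exists (g \o f); apply: bij_comp. Qed.

Lemma cycle_sym_iso (s : cycle_sym) i : isomorphic (G i) (G (s i)).
Proof. by case/asboolP: (cycle_symP s) => _ h; apply/isomorphic_sym. Qed.

Lemma cycle_sym_adj (s : cycle_sym) i j :
  cycle_adj (s i) (s j) = cycle_adj i j.
Proof. by case/asboolP: (cycle_symP s). Qed.

Lemma cs_one_subproof : cycle_sym_pred 1.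
Proof.
apply/asboolP; split=> [i j|i]; rewrite !perm1 //; exact: isomorphic_refl.
Qed.

Definition cs_one := CycleSym cs_one_subproof.

Lemma cs_mul_subproof (s t : cycle_sym) :
  cycle_sym_pred (cycle_perm t * cycle_perm s).
Proof.
apply/asboolP; split=> [i j|i]; rewrite !permM ?cycle_sym_adj //.
exact/isomorphic_sym/(isomorphic_trans (cycle_sym_iso t i))/cycle_sym_iso.
Qed.

(* The product is composition of maps, hence opposite to that of {perm 'Z_n}. *)
Definition cs_mul (s t : cycle_sym) : cycle_sym :=
  CycleSym (cs_mul_subproof s t).

Lemma cs_inv_subproof (s : cycle_sym) : cycle_sym_pred (cycle_perm s)^-1.
Proof.
apply/asboolP; split=> [i j|i]; first by rewrite -(cycle_sym_adj s) !permKV.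
by have := cycle_sym_iso s ((cycle_perm s)^-1 i); rewrite permKV.
Qed.

Definition cs_inv (s : cycle_sym) : cycle_sym := CycleSym (cs_inv_subproof s).

Lemma cs_mulE (s t : cycle_sym) i : cs_mul s t i = s (t i).
Proof. by rewrite permM. Qed.

Lemma cs_mulA : associative cs_mul.
Proof. by move=> s t u; apply/val_inj; rewrite /= mulgA. Qed.
Lemma cs_mul1 : left_id cs_one cs_mul.
Proof. by move=> s; apply/val_inj; rewrite /= mulg1. Qed.
Lemma cs_1mul : right_id cs_one cs_mul.
Proof. by move=> s; apply/val_inj; rewrite /= mul1g. Qed.
Lemma cs_mulV : left_inverse cs_one cs_inv cs_mul.
Proof. by move=> s; apply/val_inj; rewrite /= mulgV. Qed.
Lemma cs_Vmul : right_inverse cs_one cs_inv cs_mul.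
Proof. by move=> s; apply/val_inj; rewrite /= mulVg. Qed.

HB.instance Definition _ :=
  isGroup.Build cycle_sym cs_mulA cs_mul1 cs_1mul cs_mulV cs_Vmul.

(* iso_map i j is only meaningful when G i and G j are isomorphic. *)
Record iso_system : Type := IsoSystem {
  iso_map :> forall i j, G i -> G j;
  iso_mapP : forall i j, isomorphic (G i) (G j) ->
    bijective (@iso_map i j) /\ {morph @iso_map i j : x y / x * y};
  iso_map_id : forall i, @iso_map i i =1 id;
  iso_map_comp : forall i j k,
    isomorphic (G i) (G j) -> isomorphic (G j) (G k) ->
    @iso_map j k \o @iso_map i j =1 @iso_map i k }.

Lemma iso_system_exists : inhabited iso_system.
Proof.
have psiP i j : exists fg : (G i -> G j) * (G j -> G i),
    isomorphic (G i) (G j) ->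
    [/\ cancel fg.1 fg.2, cancel fg.2 fg.1 & {morph fg.1 : x y / x * y}].
  case: (pselect (isomorphic (G i) (G j))) => [[f [g fK gK]]|nij].
    by exists (f : _ -> _, g) => _; split=> //; apply: gmulfM.
  by exists (fun=> 1, fun=> 1).
pose psi i j := (sval (cid (psiP i j))).1.
pose psiV i j := (sval (cid (psiP i j))).2.
have psiK i j : isomorphic (G i) (G j) ->
    [/\ cancel (psi i j) (psiV i j), cancel (psiV i j) (psi i j)
      & {morph psi i j : x y / x * y}].
  exact: (svalP (cid (psiP i j))).
pose r i := odflt i [pick j | `[< isomorphic (G i) (G j) >]].
have r_iso i : isomorphic (G (r i)) (G i).
  rewrite /r; case: pickP => [j /asboolP|_]; first exact: isomorphic_sym.
  exact: isomorphic_refl.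
have r_eq i j : isomorphic (G i) (G j) -> r i = r j.
  move=> ij; rewrite /r.
  have -> : [pick k | `[< isomorphic (G i) (G k) >]]
          = [pick k | `[< isomorphic (G j) (G k) >]].
    apply: eq_pick => k; apply/asboolP/asboolP; apply: isomorphic_trans => //.
    exact: isomorphic_sym.
  case: pickP => // /(_ j) /asboolP[]; exact: isomorphic_refl.
pose th i j (x : G i) : G j := psi (r i) j (psiV (r i) i x).
have rij i j : isomorphic (G i) (G j) -> isomorphic (G (r i)) (G j).
  exact: isomorphic_trans.
have th_id i : th i i =1 id.
  by move=> x; rewrite /th; case: (psiK _ _ (r_iso i)) => _ ->.
have th_comp i j k : isomorphic (G i) (G j) -> isomorphic (G j) (G k) ->
    th j k \o th i j =1 th i k.
  move=> ij jk x /=; rewrite /th -(r_eq _ _ ij).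
  by case: (psiK _ _ (rij _ _ ij)) => ->.
constructor; apply: (@IsoSystem th) => // i j ij; split.
  have ji := isomorphic_sym ij.
  exists (th j i) => x.
    by rewrite -[RHS]th_id -(th_comp i j i ij ji).
  by rewrite -[RHS]th_id -(th_comp j i j ji ij).
move=> x y; rewrite /th.
have [_ pK pM] := psiK _ _ (r_iso i); have [_ _ qM] := psiK _ _ (rij _ _ ij).
have [pK' _ _] := psiK _ _ (r_iso i).
by rewrite -qM; congr psi; apply: (can_inj pK'); rewrite pM !pK.
Qed.

Variable theta : iso_system.

Lemma iso_mapK i j : isomorphic (G i) (G j) ->
  cancel (theta i j) (theta j i).
Proof.
move=> ij x; have ji := isomorphic_sym ij.
by rewrite -[RHS](iso_map_id theta) -(iso_map_comp theta ij ji).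
Qed.

Lemma cycle_sym_invP (s : cycle_sym) j :
  isomorphic (G ((s : {perm _})^-1 j)) (G j).
Proof. by have := cycle_sym_iso s ((s : {perm _})^-1 j); rewrite permKV. Qed.

Definition vertex_auts : Type := group_prod (fun i => autgroup (G i)).
HB.instance Definition _ := Group.on vertex_auts.

Lemma transport_subproof i j (ij : isomorphic (G i) (G j))
    (a : autgroup (G i)) :
  `[< bijective (theta i j \o a \o theta j i) /\
      {morph theta i j \o a \o theta j i : x y / x * y} >].
Proof.
have [bij ijM] := iso_mapP theta ij.
have [bji jiM] := iso_mapP theta (isomorphic_sym ij).
apply/asboolP; split; last by move=> x y; rewrite /= jiM autgroupM ijM.
by apply: bij_comp => //; apply: bij_comp => //; apply: aut_bij.
Qed.

(* theta_{i,j} o a o theta_{i,j}^-1, as theta_{j,i} inverts theta_{i,j}. *)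
Definition transport i j (ij : isomorphic (G i) (G j)) (a : autgroup (G i)) :
  autgroup (G j) := AutGroup (transport_subproof ij a).

Definition sym_fun (s : cycle_sym) (a : vertex_auts) : vertex_auts :=
  fun j => transport (cycle_sym_invP s j) (a ((s : {perm _})^-1 j)).

Lemma sym_funE (s : cycle_sym) (a : vertex_auts) i (x : G i) :
  sym_fun s a (s i) (theta i (s i) x) = theta i (s i) (a i x).
Proof.
rewrite /= permK iso_mapK //; exact: cycle_sym_iso.
Qed.

Lemma vertex_autsE (s : cycle_sym) (a b : vertex_auts) :
  (forall i (x : G i), a (s i) (theta i (s i) x) = b (s i) (theta i (s i) x)) ->
  a = b.
Proof.
move=> ab; apply/functional_extensionality_dep => j; apply: autgroup_ext => y.
rewrite -(permKV (s : {perm _}) j) in y *.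
set i := (s : {perm _})^-1 j in y *.
have ij := cycle_sym_iso s i.
by rewrite -(iso_mapK (isomorphic_sym ij) y) ab.
Qed.

Lemma sym_fun1 : sym_fun 1 =1 id.
Proof.
move=> a; apply: (@vertex_autsE 1) => i x; rewrite sym_funE.
rewrite [(1 : cycle_sym) i]perm1.
by rewrite !iso_map_id.
Qed.

Lemma sym_funM (s t : cycle_sym) : sym_fun (s * t) =1 sym_fun s \o sym_fun t.
Proof.
move=> a; apply: (@vertex_autsE (s * t)) => i x; rewrite sym_funE.
rewrite [(s * t) i]cs_mulE.
have hi := cycle_sym_iso t i; have hti := cycle_sym_iso s (t i).
rewrite -!(iso_map_comp theta hi hti).
rewrite -[RHS]/(sym_fun s (sym_fun t a) _ (theta _ _ (theta _ _ x))).
by rewrite !sym_funE.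
Qed.

Lemma sym_act_subproof (s : cycle_sym) :
  `[< bijective (sym_fun s) /\ {morph sym_fun s : a b / a * b} >].
Proof.
apply/asboolP; split.
  exists (sym_fun s^-1) => a.
    by rewrite -[LHS]/((sym_fun _ \o sym_fun _) a) -sym_funM mulVg sym_fun1.
  by rewrite -[LHS]/((sym_fun _ \o sym_fun _) a) -sym_funM mulgV sym_fun1.
move=> a b; apply: (@vertex_autsE s) => i x; rewrite sym_funE.
by rewrite -[RHS]/(sym_fun s a _ (sym_fun s b _ _)) !sym_funE.
Qed.

Definition sym_act (s : cycle_sym) : autgroup vertex_auts :=
  AutGroup (sym_act_subproof s).

Lemma sym_actM : {morph sym_act : s t / s * t}.
Proof. by move=> s t; apply: autgroup_ext; apply: sym_funM. Qed.

HB.instance Definition _ :=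
  isMultiplicative.Build cycle_sym (autgroup vertex_auts) sym_act sym_actM.

(* (prod_i Aut(G_i)) >< Sym *)
Definition local_auts : Type := semidirect sym_act.
HB.instance Definition _ := Group.on local_auts.

Definition local_letter (u : local_auts) (l : letter G) : letter G :=
  let: (a, s) := u in
  let i := tag l in Tagged G (a (s i) (theta i (s i) (tagged l))).

Lemma local_letter_cong u w1 w2 :
  gp_cong (@cycle_adj n) w1 w2 ->
  gp_cong (@cycle_adj n) (map (local_letter u) w1) (map (local_letter u) w2).
Proof.
case: u => a s; elim => {w1 w2} /=.
- by move=> *; apply: gpc_refl.
- by move=> *; apply: gpc_sym.
- by move=> *; apply: gpc_trans; eassumption.
- by move=> *; rewrite !map_cat; apply: gpc_cat.
- move=> i; have [_ ijM] := iso_mapP theta (cycle_sym_iso s i).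
  have -> : theta i (s i) 1 = 1.
    by apply: (mulgI (theta i (s i) 1)); rewrite -ijM !mulg1.
  by rewrite sd_aut1; apply: gpc_one.
- move=> i g h; have [_ ijM] := iso_mapP theta (cycle_sym_iso s i).
  by rewrite ijM autgroupM; apply: gpc_mul.
- by move=> i j g h ij; apply: gpc_comm; rewrite cycle_sym_adj.
Qed.

Definition local_fun (u : local_auts) (x : cyclic_product G) :
  cyclic_product G := gprod_of_word _ (map (local_letter u) (repr x)).

Lemma local_fun_word u w :
  local_fun u (gprod_of_word _ w) = gprod_of_word _ (map (local_letter u) w).
Proof. exact/gprod_of_wordP/local_letter_cong/repr_gprod. Qed.

Lemma local_fun_in (a : vertex_auts) (s : cycle_sym) i (g : G i) :
  local_fun (a, s) (gprod_in _ g) =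
  gprod_in _ (a (s i) (theta i (s i) g)).
Proof. exact: local_fun_word. Qed.

Lemma local_fun1 : local_fun 1 =1 id.
Proof.
elim/gprod_ind => w; rewrite local_fun_word; congr gprod_of_word.
rewrite -[RHS]map_id; apply: eq_map => -[i g] /=.
by rewrite [(1 : cycle_sym) i]perm1 iso_map_id.
Qed.

Lemma local_funM (u v : local_auts) :
  local_fun (u * v) =1 local_fun u \o local_fun v.
Proof.
elim/gprod_ind => w /=; rewrite !local_fun_word; congr gprod_of_word.
rewrite -map_comp; apply: eq_map => -[i g] /=.
case: u v => [a s] [b t] /=.
rewrite [(s * t) i]cs_mulE.
rewrite -(iso_map_comp theta (cycle_sym_iso t i) (cycle_sym_iso s (t i))).
congr (Tagged G _).
by rewrite -[LHS]/(a _ (sym_fun s b _ (theta _ _ _))) sym_funE.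
Qed.

Lemma local_act_subproof (u : local_auts) :
  `[< bijective (local_fun u) /\ {morph local_fun u : x y / x * y} >].
Proof.
apply/asboolP; split.
  exists (local_fun u^-1) => x.
    rewrite -[LHS]/((local_fun _ \o local_fun _) x).
    by rewrite -local_funM mulVg local_fun1.
  rewrite -[LHS]/((local_fun _ \o local_fun _) x).
  by rewrite -local_funM mulgV local_fun1.
elim/gprod_ind => w1; elim/gprod_ind => w2.
have E (v1 v2 : word G) : gprod_of_word (@cycle_adj n) v1 * gprod_of_word _ v2
  = gprod_of_word _ (v1 ++ v2) by exact: gprod_mulE.
by rewrite E !local_fun_word map_cat -E.
Qed.

Definition local_act (u : local_auts) : autgroup (cyclic_product G) :=
  AutGroup (local_act_subproof u).

Lemma local_actM : {morph local_act : u v / u * v}.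
Proof. by move=> u v; apply: autgroup_ext; apply: local_funM. Qed.

HB.instance Definition _ :=
  isMultiplicative.Build local_auts (autgroup (cyclic_product G))
    local_act local_actM.

End CyclicProduct.

Arguments sym_act {n G} theta s.
Arguments local_act {n G} theta u.

(* Main.v *)
Require Import Defs.
From mathcomp Require Import all_boot all_order all_algebra all_fingroup.
From HB Require Import structures.
From mathcomp Require Import generic_quotient boolp ring.

(* The walls of type k are the cosets x S_k of the star subgroup
   S_k = G_k x (G_{k-1} * G_{k+1}), and the head of x in G_k, i.e. its first
   syllable, tells which sector of the wall S_k contains x. Let phi be an
   automorphism.

   Each phi(G_i) is contained in a conjugate of a vertex group. Indeed, whatever
   commutes with a nontrivial element of G_k lies in S_k, and a subgroup of S_k
   which stabilizes a second wall of type k lies in a conjugate of a vertex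
   group. Thus, if phi(G_i) is contained in a conjugate of some S_k but not in
   one of a vertex group, then that conjugate also contains phi(G_{i-1}) and
   phi(G_{i+1}), then the next ones around the cycle, and finally everything.
   What starts this process is that of two commuting elements a of phi(G_0) and
   b of phi(G_1) one lies in a conjugate of a star subgroup: otherwise a
   translates the walls of some type along an axis that b preserves, and a
   nontrivial product of powers of a and b fixes this axis; it commutes with a
   and lies in a conjugate of a vertex group, whence a is in a star.

   Then phi(G_i) acts by rotations about a wall J_i, and J_i, J_j cross when i
   and j are adjacent. As the complement of a star in C_n is connected, all the
   J_j which do not cross J_i lie in one sector of J_i. These n sectors have a
   common point y, which is unique by a ping-pong argument as the phi(G_i)
   generate the whole group. Hence the J_i are the n walls through y, and phi
   followed by the conjugation by y permutes the vertex groups. *)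

Set Implicit Arguments.
Unset Strict Implicit.
Unset Printing Implicit Defensive.

Local Open Scope group_scope.

(** * Normal forms in graph products *)

Section Heads.
Variables (V : choiceType) (adj : rel V) (G : V -> groupType).
Hypotheses (adj_sym : symmetric adj) (adj_irr : irreflexive adj).

Definition piling := forall v, seq (option (G v)).

Definition phead v (p : piling) : G v :=
  if p v is Some g :: _ then g else 1.

(* Pushing a letter of G v also puts a marker None on the stacks of the other
   vertices that are not adjacent to v, so that words which differ by a shuffle
   of commuting letters have equal pilings. *)
Definition push v (g : G v) (p : piling) : piling := fun w =>
  match v =P w with
  | ReflectT e => Some (eq_rect v G g w e) :: p w
  | ReflectF _ => if adj v w then p w else None :: p w
  end.

Definition pop v (p : piling) : piling := fun w =>
  if (v != w) && adj v w then p w else behead (p w).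

Lemma push_same v (g : G v) p : push g p v = Some g :: p v.
Proof. by rewrite /push; case: eqP => // e; rewrite eq_axiomK. Qed.

Lemma push_adj v w (g : G v) p : adj v w -> push g p w = p w.
Proof.
move=> vw; rewrite /push; case: eqP => [e|_]; last by rewrite vw.
by rewrite e adj_irr in vw.
Qed.

Lemma push_nadj v w (g : G v) p :
  v != w -> ~~ adj v w -> push g p w = None :: p w.
Proof. by rewrite /push; case: eqP => // _ _ /negbTE ->. Qed.

Lemma phead_push v (g : G v) p : phead v (push g p) = g.
Proof. by rewrite /phead push_same. Qed.

Lemma phead_push_adj v w (g : G v) p : adj v w ->
  phead w (push g p) = phead w p.
Proof. by move=> vw; rewrite /phead push_adj. Qed.

Lemma phead_push_nadj v w (g : G v) p :
  v != w -> ~~ adj v w -> phead w (push g p) = 1.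
Proof. by move=> vw nvw; rewrite /phead push_nadj. Qed.

Lemma pushK v (g : G v) p : pop v (push g p) = p.
Proof.
apply/functional_extensionality_dep => w; rewrite /pop.
have [<-|vw] /= := eqVneq v w; first by rewrite push_same.
by case: ifPn => vw'; [rewrite push_adj | rewrite push_nadj].
Qed.

Lemma push_comm v w (g : G v) (h : G w) p : adj v w ->
  push g (push h p) = push h (push g p).
Proof.
move=> vw; have wv : adj w v by rewrite adj_sym.
apply/functional_extensionality_dep => u.
have [<-|vu] := eqVneq v u;
  first by rewrite push_same !(push_adj _ _ wv) push_same.
have [<-|wu] := eqVneq w u;
  first by rewrite push_same !(push_adj _ _ vw) push_same.
have [vu'|vu'] := boolP (adj v u); have [wu'|wu'] := boolP (adj w u);
by rewrite ?(push_adj _ _ vu') ?(push_adj _ _ wu') ?(push_nadj _ _ vu vu')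
   ?(push_nadj _ _ wu wu') ?(push_adj _ _ vu') ?(push_adj _ _ wu')
   ?(push_nadj _ _ vu vu') ?(push_nadj _ _ wu wu').
Qed.

Definition pempty : piling := fun=> [::].

(* The pilings of reduced words. *)
Inductive valid : piling -> Prop :=
| valid_empty : valid pempty
| valid_push v (g : G v) p :
    g <> 1 -> phead v p = 1 -> valid p -> valid (push g p).

(** The top syllable is at [v], or adjacent to [v] and can be moved below the head, or it leaves a
    marker that hides the head. *)
Lemma valid_head v p : valid p -> phead v p <> 1 ->
  exists q, [/\ valid q, phead v q = 1 & p = push (phead v p) q].
Proof.
elim=> {p} [|w g p g1 hp vp IH]; first by [].
have [<-|wv] := eqVneq w v; first by rewrite phead_push => _; exists p.
have [awv|nwv] := boolP (adj w v); last by rewrite phead_push_nadj.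
rewrite phead_push_adj // => /IH[q [vq hq pE]]; exists (push g q); split.
- by apply: valid_push => //; rewrite -hp pE phead_push_adj // adj_sym.
- by rewrite phead_push_adj.
- by rewrite {1}pE push_comm.
Qed.

Definition pcons v (g : G v) p : piling := if g == 1 then p else push g p.

Lemma valid_pcons v (g : G v) p : phead v p = 1 -> valid p -> valid (pcons g p).
Proof. by rewrite /pcons; case: eqP => // g1 h1 vp; apply: valid_push. Qed.

Lemma pcons_comm v w (g : G v) (h : G w) p : adj v w ->
  pcons g (pcons h p) = pcons h (pcons g p).
Proof. by move=> vw; rewrite /pcons; do 2!case: eqP => // ?;
  apply: push_comm. Qed.

Lemma phead_pcons v (g : G v) p : phead v p = 1 -> phead v (pcons g p) = g.
Proof. by rewrite /pcons; case: eqP => [->|] // _ _; rewrite phead_push. Qed.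

Lemma phead_pcons_adj v w (g : G v) p : adj v w ->
  phead w (pcons g p) = phead w p.
Proof. by move=> vw; rewrite /pcons; case: eqP => // _;
  rewrite phead_push_adj. Qed.

Lemma valid_split v p : valid p ->
  exists q, [/\ valid q, phead v q = 1 & p = pcons (phead v p) q].
Proof.
move=> vp; have [p1|/eqP p1] := eqVneq (phead v p) 1.
  by exists p; rewrite /pcons p1 eqxx.
by have [q [? ? ?]] := valid_head vp p1; exists q; rewrite /pcons; case: eqP.
Qed.

(** Left multiplication by [g] on normal forms: the head at [v] is taken off, multiplied by [g], and
    put back unless it became trivial. *)
Definition pact v (g : G v) p : piling :=
  pcons (g * phead v p) (if phead v p == 1 then p else pop v p).

Lemma pact_pcons v (g h : G v) p : phead v p = 1 ->
  pact g (pcons h p) = pcons (g * h) p.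
Proof.
move=> hp; rewrite /pact phead_pcons //; congr pcons.
by rewrite /pcons; case: eqP => // _; rewrite pushK.
Qed.

Lemma valid_pact v (g : G v) p : valid p -> valid (pact g p).
Proof.
move=> vp; have [q [vq hq ->]] := valid_split v vp.
by rewrite pact_pcons //; apply: valid_pcons.
Qed.

Definition pact_word (w : word G) : piling -> piling :=
  foldr (fun l p => pact (tagged l) p) ^~ w.

Lemma valid_pact_word w p : valid p -> valid (pact_word w p).
Proof. by move=> vp; elim: w => //= l w IH; apply: valid_pact. Qed.

Lemma pact_word_cat w1 w2 p :
  pact_word (w1 ++ w2) p = pact_word w1 (pact_word w2 p).
Proof. by rewrite /pact_word foldr_cat. Qed.

(** Van der Waerden's method: the defining relations hold for the action on pilings of reduced
    words, so heads descend to the graph product. *)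
Lemma pact_word_cong w1 w2 : gp_cong adj w1 w2 ->
  forall p, valid p -> pact_word w1 p = pact_word w2 p.
Proof.
elim=> {w1 w2} //.
- by move=> w1 w2 _ IH p vp; rewrite IH.
- by move=> w1 w2 w3 _ IH1 _ IH2 p vp; rewrite IH1 // IH2.
- move=> w1 w2 w3 w4 _ IH1 _ IH2 p vp; rewrite !pact_word_cat IH2 // IH1 //.
  exact: valid_pact_word.
- move=> v p vp /=; have [q [vq hq ->]] := valid_split v vp.
  by rewrite pact_pcons // mul1g.
- move=> v g h p vp /=; have [q [vq hq ->]] := valid_split v vp.
  by rewrite !pact_pcons // mulgA.
- move=> v w g h vw p vp /=; have [q [vq hq ->]] := valid_split v vp.
  have [r [vr hr qE]] := valid_split w vq; set a := phead v p.
  have wv : adj w v by rewrite adj_sym.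
  have hrv : phead v r = 1 by rewrite -hq qE phead_pcons_adj.
  have swap (c : G v) (d : G w) : pcons c (pcons d r) = pcons d (pcons c r).
    exact: pcons_comm.
  have actv (c : G v) (d : G w) :
    pact g (pcons c (pcons d r)) = pcons (g * c) (pcons d r).
    by rewrite pact_pcons ?phead_pcons_adj.
  have actw (c : G w) (d : G v) :
    pact h (pcons c (pcons d r)) = pcons (h * c) (pcons d r).
    by rewrite pact_pcons ?phead_pcons_adj.
  rewrite qE [RHS](congr1 _ (actv _ _)) [X in _ = pact h X]swap actw.
  by rewrite [X in pact g (pact h X)]swap actw -!swap actv.
Qed.

Local Notation W := (graph_product adj G).
Local Notation "[ 'of' w ]" := (gprod_of_word adj w) (format "[ 'of'  w ]").
Local Notation iota := (gprod_in adj).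

(* The first syllable of x in G v: the g with x = g y, where no letter of G v
   can be shuffled to the front of y. *)
Definition ghead v (x : W) : G v := phead v (pact_word (repr x) pempty).

Lemma head_word v w : ghead v [of w] = phead v (pact_word w pempty).
Proof.
rewrite /ghead (pact_word_cong (repr_gprod adj w)) //; exact: valid_empty.
Qed.

Lemma wordM w1 w2 : [of w1] * [of w2] = [of w1 ++ w2] :> W.
Proof. exact: gprod_mulE. Qed.

Lemma word_cons l w : [of l :: w] = iota (tagged l) * [of w] :> W.
Proof. by rewrite wordM; case: l. Qed.

Lemma word_nil : [of [::]] = 1 :> W. Proof. by []. Qed.

Lemma iota1 v : iota (1 : G v) = 1 :> W.
Proof. exact/gprod_of_wordP/gpc_one. Qed.

Lemma iotaM v (g h : G v) : iota (g * h) = iota g * iota h :> W.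
Proof. by rewrite wordM; apply/gprod_of_wordP/gpc_sym/gpc_mul. Qed.

Lemma iotaV v (g : G v) : iota g^-1 = (iota g)^-1 :> W.
Proof. by apply: (mulgI (iota g)); rewrite -iotaM !mulgV iota1. Qed.

Lemma iotaC v w (g : G v) (h : G w) : adj v w ->
  iota g * iota h = iota h * iota g :> W.
Proof. by move=> vw; rewrite !wordM; apply/gprod_of_wordP/gpc_comm. Qed.

Lemma head1 v : ghead v 1 = 1.
Proof. by rewrite -word_nil head_word. Qed.

Lemma headM v (g : G v) (x : W) : ghead v (iota g * x) = g * ghead v x.
Proof.
elim/gprod_ind: x => w; rewrite wordM !head_word /=.
have vp := valid_pact_word w valid_empty.
have [q [vq hq ->]] := valid_split v vp.
by rewrite pact_pcons // !phead_pcons.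
Qed.

Lemma headM_adj v w (g : G v) (x : W) : adj v w ->
  ghead w (iota g * x) = ghead w x.
Proof.
move=> vw; elim/gprod_ind: x => u; rewrite wordM !head_word /=.
have vp := valid_pact_word u valid_empty.
have [q [vq hq ->]] := valid_split v vp.
by rewrite pact_pcons // !phead_pcons_adj.
Qed.

Lemma head_nadj v w (x : W) : v != w -> ~~ adj v w ->
  ghead v x <> 1 -> ghead w x = 1.
Proof.
move=> vw nvw; elim/gprod_ind: x => u; rewrite !head_word => h1.
have vp := valid_pact_word u valid_empty.
by have [q [vq hq ->]] := valid_head vp h1; rewrite phead_push_nadj.
Qed.

Lemma head_iota v (g : G v) : ghead v (iota g) = g.
Proof. by rewrite -[iota g]mulg1 headM head1 mulg1. Qed.

Lemma wordV w : [of w]^-1 = [of inv_word w] :> W.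
Proof.
apply: (mulgI [of w]); rewrite mulgV wordM.
exact/esym/gprod_of_wordP/gp_cong_invr.
Qed.

Lemma strip_word w v : ghead v [of w] <> 1 ->
  exists w', [/\ size w' < size w,
    forall A : pred V, all (A \o tag) w -> A v && all (A \o tag) w'
    & [of w] = iota (ghead v [of w]) * [of w'] :> W].
Proof.
have [n] := ubnP (size w); elim: n => // n IH in w v *.
case: w => [_ /(_ (head1 v)) //|[u g] w] /= szw.
rewrite word_cons /=; have [<-|uv] := eqVneq u v.
  have [hw _|/eqP hw _] := eqVneq (ghead u [of w]) 1.
    by exists w; split=> //; rewrite headM hw mulg1.
  have [w' [sw' Aw' wE]] := IH _ _ szw hw; exists w'; split=> //.
  - exact: ltnW.
  - by move=> A /= /andP[_ /Aw'].
  - by rewrite {1}wE headM mulgA -iotaM.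
have [uv'|uv'] := boolP (adj u v).
  rewrite headM_adj // => hw; have [w' [sw' Aw' wE]] := IH _ _ szw hw.
  exists (Tagged G g :: w'); split=> //.
  - by move=> A /= /andP[-> /Aw'].
  - by rewrite {1}wE word_cons /= !mulgA iotaC.
(* A nontrivial head at [u] would hide the head at [v]; hence [g] cancels against the head of the
   rest. *)
move=> hv; have [hu|/eqP hu] := eqVneq (ghead u (iota g * [of w])) 1;
  last first.
  by case: hv; exact: head_nadj hu.
move: hu; rewrite headM => hu; have gE : g = (ghead u [of w])^-1.
  by apply: (mulIg (ghead u [of w])); rewrite hu mulVg.
have [h1|/eqP h1] := eqVneq (ghead u [of w]) 1.
  move: hv; rewrite gE h1 invg1 iota1 mul1g => hv.
  have [w' [sw' Aw' wE]] := IH _ _ szw hv; exists w'; split=> //.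
    exact: ltnW.
  by move=> A /= /andP[_ /Aw'].
have [w' [sw' Aw' wE]] := IH _ _ szw h1.
have gw : iota g * [of w] = [of w'] :> W.
  by rewrite gE wE mulgA -wE iotaV mulVg mul1g.
rewrite gw in hv *.
have [w2 [sw2 Aw2 w2E]] := IH w' v (leq_trans sw' (ltnW szw)) hv.
exists w2; split=> //; first by rewrite ltnS ltnW // (ltn_trans sw2).
by move=> A /= /andP[_ /Aw' /andP[_ /Aw2]].
Qed.

(** * Word length and induction on syllables *)

Lemma len_subproof (x : W) :
  exists n, `[< exists2 w, size w = n & x = [of w] >].
Proof.
elim/gprod_ind: x => w.
by exists (size w); apply/asboolP; exists w.
Qed.

Definition len (x : W) : nat := ex_minn (len_subproof x).

Lemma lenP (x : W) : exists2 w, size w = len x & x = [of w].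
Proof. by rewrite /len; case: ex_minnP => n /asboolP. Qed.

Lemma len_word w : len [of w] <= size w.
Proof.
rewrite /len; case: ex_minnP => n _; apply.
by apply/asboolP; exists w.
Qed.

Lemma lenV (x : W) : len x^-1 = len x.
Proof.
have le y : len y^-1 <= len y.
  have [w <- ->] := lenP y; rewrite wordV; apply: leq_trans (len_word _) _.
  by rewrite /inv_word size_rev size_map.
by apply/eqP; rewrite eqn_leq le -{1}[x]invgK le.
Qed.

Lemma len_iotaM v (g : G v) (x : W) : len (iota g * x) <= (len x).+1.
Proof.
have [w <- ->] := lenP x; rewrite wordM.
by apply: leq_trans (len_word _) _; rewrite size_cat.
Qed.

Lemma len_strip v (x : W) : ghead v x <> 1 ->
  len (iota (ghead v x)^-1 * x) < len x.
Proof.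
have [w <- ->] := lenP x => /strip_word[w' [sw' _ E]].
by rewrite {2}E mulgA -iotaM mulVg iota1 mul1g; apply: leq_ltn_trans sw';
  apply: len_word.
Qed.

(** Otherwise the first letter of a shortest word would cancel against the head of the remaining
    word, leaving a shorter word. *)
Lemma head_ex (x : W) : x <> 1 -> exists v, ghead v x <> 1.
Proof.
move=> x1; apply: contrapT => nh; apply: x1.
have hx v : ghead v x = 1 by apply: contrapT => h; apply: nh; exists v.
have [[|[v g] w] sw xE] := lenP x; first by rewrite xE.
have hw : g * ghead v [of w] = 1.
  by rewrite -headM -(word_cons (Tagged G g)) -xE hx.
have xE' : x = iota g * [of w] by rewrite xE word_cons.
have gE : g = (ghead v [of w])^-1.
  by apply: (mulIg (ghead v [of w])); rewrite hw mulVg.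
suff : len x < len x by rewrite ltnn.
rewrite -{2}sw /= ltnS {1}xE' gE.
have [->|/eqP h1] := eqVneq (ghead v [of w]) 1.
  by rewrite invg1 iota1 mul1g len_word.
exact: leq_trans (ltnW (len_strip h1)) (len_word w).
Qed.

Lemma head_strip v (x : W) : ghead v (iota (ghead v x)^-1 * x) = 1.
Proof. by rewrite headM mulVg. Qed.

Lemma stripK v (x : W) : x = iota (ghead v x) * (iota (ghead v x)^-1 * x).
Proof. by rewrite mulgA -iotaM mulgV iota1 mul1g. Qed.

Lemma head_ind (P : W -> Prop) : P 1 ->
    (forall v (g : G v) y, g <> 1 -> ghead v y = 1 -> P y -> P (iota g * y)) ->
  forall x, P x.
Proof.
move=> P1 PM x; have [n] := ubnP (len x); elim: n => // n IH in x *.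
rewrite ltnS => lx; have [->//|/eqP x1] := eqVneq x 1.
have [v hv] := head_ex x1; rewrite (stripK v x); apply: PM => //.
  exact: head_strip.
exact/IH/(leq_trans (len_strip hv)).
Qed.

Lemma tail_ind (P : W -> Prop) : P 1 ->
    (forall v (g : G v) y, g <> 1 -> ghead v y^-1 = 1 -> P y ->
      P (y * iota g)) ->
  forall x, P x.
Proof.
move=> P1 PM x; rewrite -[x]invgK; elim/head_ind: x^-1 => [|v g y g1 hy IH].
  by rewrite invg1.
rewrite invMg -iotaV; apply: PM => //; last by rewrite invgK.
by move=> gV; apply: g1; rewrite -[g]invgK gV invg1.
Qed.

(* The parabolic subgroup generated by the G v with v in A. *)
Definition par (A : pred V) (x : W) : Prop :=
  exists2 w : word G, all (A \o tag) w & x = [of w].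

Lemma par1 A : par A 1.
Proof. by exists [::]. Qed.

Lemma parM A x y : par A x -> par A y -> par A (x * y).
Proof.
move=> [w1 A1 ->] [w2 A2 ->]; exists (w1 ++ w2); first by rewrite all_cat A1.
by rewrite wordM.
Qed.

Lemma par_iota (A : pred V) v (g : G v) : A v -> par A (iota g : W).
Proof. by move=> Av; exists [:: Tagged G g] => //=; rewrite Av. Qed.

Lemma parS (A B : pred V) x : (forall v, A v -> B v) -> par A x -> par B x.
Proof.
move=> AB [w Aw ->]; exists w => //; apply: sub_all Aw => l; exact: AB.
Qed.

Lemma par_ind (A : pred V) (P : W -> Prop) : P 1 ->
    (forall v (g : G v) y, A v -> par A y -> P y -> P (iota g * y)) ->
  forall x, par A x -> P x.
Proof.
move=> P1 PM x [w Aw ->]; elim: w Aw => [//|[v g] w IH] /= /andP[Av Aw].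
by rewrite word_cons; apply: PM => //; [exists w | apply: IH].
Qed.

Lemma parV A x : par A x -> par A x^-1.
Proof.
elim/par_ind=> [|v g y Av _ IH]; first by rewrite invg1; exact: par1.
by rewrite invMg -iotaV; apply: parM => //; apply: par_iota.
Qed.

Lemma par_strip A v x : par A x -> ghead v x <> 1 ->
  A v /\ par A (iota (ghead v x)^-1 * x).
Proof.
move=> [w Aw ->] /strip_word[w' [_ /(_ A Aw)/andP[Av Aw'] E]]; split=> //.
by rewrite {2}E mulgA -iotaM mulVg iota1 mul1g; exists w'.
Qed.

Lemma par_head (A : pred V) v x : par A x -> ~~ A v -> ghead v x = 1.
Proof.
move=> Ax nA; apply: contrapT => /(par_strip Ax)[Av _].
by rewrite Av in nA.
Qed.

Lemma par_tail_ind (A : pred V) v (g : G v) (y : W) :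
  g <> 1 -> ghead v y = 1 -> par A (iota g * y) -> A v /\ par A y.
Proof.
move=> g1 hy Agy; have hE : ghead v (iota g * y) = g by rewrite headM hy mulg1.
have hv : ghead v (iota g * y) <> 1 by rewrite hE.
by have [Av] := par_strip Agy hv; rewrite hE mulgA -iotaM mulVg iota1 mul1g.
Qed.

Lemma parI A B x : par A x -> par B x -> par (predI A B) x.
Proof.
elim/head_ind: x => [|v g y g1 hy IH] Ax Bx; first exact: par1.
have [Av Ay] := par_tail_ind g1 hy Ax; have [Bv By] := par_tail_ind g1 hy Bx.
by apply: parM; [apply: par_iota; rewrite /= Av | apply: IH].
Qed.

Lemma par_heads (A : pred V) x : par A x ->
  (forall v, A v -> ghead v x = 1) -> x = 1.
Proof.
move=> Ax hx; apply: contrapT => /head_ex[v hv].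
by have [/hx] := par_strip Ax hv.
Qed.

(** * Star subgroups and the relative position of their walls *)

Definition star v : pred V := fun u => (u == v) || adj v u.

Lemma star_refl v : star v v. Proof. by rewrite /star eqxx. Qed.

Lemma star_sym u v : star u v = star v u.
Proof. by rewrite /star eq_sym adj_sym. Qed.

(** [S v] acts on the sectors of its wall by left translation through [ghead v], a homomorphism on
    [S v] with kernel the link subgroup [D v]. *)
Local Notation S v := (par (star v)).
Local Notation D v := (par (adj v)).

Lemma parDS v x : D v x -> S v x.
Proof. by apply: parS => u; rewrite /star => ->; rewrite orbT. Qed.

Lemma head_nstar u v (x : W) : ~~ star u v -> ghead u x <> 1 -> ghead v x = 1.
Proof.
rewrite /star eq_sym negb_or => /andP[uv nuv]; exact: head_nadj.
Qed.

Lemma head_iota_neq u v (g : G u) : u != v -> ghead v (iota g) = 1.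
Proof.
move=> uv; apply: (@par_head (pred1 u)); last first.
  by rewrite /= eq_sym.
apply: par_iota; exact: eqxx.
Qed.

Lemma headDM v d x : D v d -> ghead v (d * x) = ghead v x.
Proof.
elim/par_ind=> [|u g y uv _ IH]; first by rewrite mul1g.
by rewrite -mulgA headM_adj // adj_sym.
Qed.

Lemma headSM v s x : S v s -> ghead v (s * x) = ghead v s * ghead v x.
Proof.
elim/par_ind=> [|u g y uv _ IH]; first by rewrite mul1g head1 mul1g.
rewrite -mulgA; case/orP: uv => [/eqP uv|uv].
  by move: g; rewrite uv => g; rewrite !headM IH mulgA.
by rewrite !headM_adj // adj_sym.
Qed.

Lemma headSV v s : S v s -> ghead v s^-1 = (ghead v s)^-1.
Proof.
move=> Ss; apply: (mulgI (ghead v s)).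
by rewrite -headSM // !mulgV head1.
Qed.

Lemma headS_D v s : S v s -> ghead v s = 1 -> D v s.
Proof.
elim/head_ind: s => [|u g y g1 hy IH] Sx hx; first exact: par1.
have [Su Sy] := par_tail_ind g1 hy Sx.
have [uv|uv] := eqVneq u v.
  by subst u; case: g1; rewrite -hx headM hy mulg1.
have vu : adj v u by move: Su; rewrite /star (negbTE uv).
apply: parM; first exact: par_iota.
by apply: IH => //; rewrite -hx headM_adj // adj_sym.
Qed.

Lemma S_split v s : S v s -> exists2 d, D v d & s = iota (ghead v s) * d.
Proof.
move=> Ss; exists (iota (ghead v s)^-1 * s); last exact: stripK.
apply: headS_D; last exact: head_strip.
by apply: parM => //; apply: par_iota; apply: star_refl.
Qed.

Lemma D_comm v d (g : G v) : D v d -> d * iota g = iota g * d.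
Proof.
elim/par_ind=> [|u h y vu _ IH]; first by rewrite mul1g mulg1.
by rewrite -mulgA IH !mulgA iotaC // adj_sym.
Qed.

Lemma S_iota v s (g : G v) : S v s ->
  s * iota g * s^-1 = iota (ghead v s * g * (ghead v s)^-1).
Proof.
move=> /S_split[d Dd {1 2}->]; rewrite invMg -!mulgA [d * _]mulgA D_comm //.
by rewrite -!mulgA [d * _]mulgA mulgV mul1g -iotaV !iotaM !mulgA.
Qed.

(* The hypothesis says that the product b w is reduced. *)
Lemma head_reducedM v (b w : W) :
  (forall u, ghead u b^-1 = 1 \/ ghead u w = 1) ->
  D v b \/ ghead v (b * w) = ghead v b.
Proof.
elim/tail_ind: b w => [|u g y g1 hy IH] w red; first by left; exact: par1.
have hu : ghead u w = 1.
  case: (red u) => //; rewrite invMg -iotaV headM hy mulg1 => gV.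
  by case: g1; rewrite -[g]invgK gV invg1.
(* Once [g] is moved to the right factor, its head at [u] hides those at the vertices not adjacent
   to [u], so reducedness need only be checked at the neighbours of [u]. *)
have IH' z : ghead u z = 1 ->
    (forall t, adj u t -> ghead t y^-1 = 1 \/ ghead t z = 1) ->
    D v y \/ ghead v (y * iota g * z) = ghead v y.
  move=> hz redz; rewrite -mulgA; apply: IH => t.
  have [<-|ut] := eqVneq u t; first by left.
  have [ut'|ut'] := boolP (adj u t); first by rewrite headM_adj //; apply: redz.
  by right; apply: (head_nadj ut ut'); rewrite headM hz mulg1.
have caseD z : ghead u z = 1 -> D v y ->
    D v (y * iota g) \/ ghead v (y * iota g * z) = ghead v (y * iota g).
  move=> hz Dy; have [ut|ut] := boolP (adj v u).
    by left; apply: parM => //; apply: par_iota.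
  right; rewrite -mulgA !(headDM _ Dy); have [uv|uv] := eqVneq u v.
    by subst u; rewrite headM hz mulg1 head_iota.
  rewrite adj_sym in ut.
  by rewrite head_iota_neq // (head_nadj uv ut) // headM hz mulg1.
(* The induction hypothesis is used with [w] and then with [1]: both products have the same head at
   [v] as [y]. *)
have [|Dy|E] := IH' w hu; [|exact: caseD|].
  by move=> t ut; case: (red t); auto; rewrite invMg -iotaV headM_adj //; left.
have [|Dy|E1] := IH' 1 (head1 u); first by move=> t _; right; exact: head1.
  exact: caseD.
by right; rewrite E -E1 mulg1.
Qed.

(** Stripping heads in [A] on the left and in [B] on the right shortens [y]; [z] is what remains
    when neither is possible. *)
Lemma double_coset (A B : pred V) (y : W) : exists s t z,
  [/\ par A s, par B t, y = s * z * t, forall v, A v -> ghead v z = 1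
    & forall v, B v -> ghead v z^-1 = 1].
Proof.
have [n] := ubnP (len y); elim: n => // n IH in y *; rewrite ltnS => ly.
have [[v [Av hv]]|nA] := pselect (exists v, A v /\ ghead v y <> 1).
  have [s [t [z [As Bt E hz hz']]]] := IH _ (leq_trans (len_strip hv) ly).
  exists (iota (ghead v y) * s), t, z; split=> //.
    by apply: parM => //; apply: par_iota.
  by rewrite {1}(stripK v y) E !mulgA.
have [[v [Bv hv]]|nB] := pselect (exists v, B v /\ ghead v y^-1 <> 1).
  have l' : len (iota (ghead v y^-1)^-1 * y^-1)^-1 < n.
    by rewrite lenV; apply: leq_trans (len_strip hv) _; rewrite lenV.
  have [s [t [z [As Bt E hz hz']]]] := IH _ l'.
  exists s, (t * iota (ghead v y^-1)^-1), z; split=> //.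
    by apply: parM => //; apply: par_iota.
  by rewrite mulgA -E invMg invgK -iotaV invgK -mulgA -iotaM mulgV iota1 mulg1.
exists 1, 1, y; rewrite mul1g mulg1; split=> [|||v Av|v Bv] //; try exact: par1.
  by apply: contrapT => hv; apply: nA; exists v.
by apply: contrapT => hv; apply: nB; exists v.
Qed.

(* Only the wall x S_v separates x from x g, for g in G v. *)
Lemma head_edge u v (g : G v) (x : W) :
  ghead u (x * iota g) <> ghead u x -> u = v /\ S v x.
Proof.
(* [t] is the last syllable of [x] in [G v]; without it, [y] followed by any syllable of [G v] is
   reduced. *)
pose t := (ghead v x^-1)^-1; pose y := x * iota t^-1.
have xE (h : G v) : x * iota h = y * iota (t * h).
  by rewrite /y -mulgA -iotaM mulKg.
have hy : ghead v y^-1 = 1 by rewrite invMg -iotaV invgK /t head_strip.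
have red (h : G v) : D u y \/ ghead u (y * iota h) = ghead u y.
  apply: head_reducedM => w; have [<-|vw] := eqVneq v w; first by left.
  by right; apply: head_iota_neq.
have x_E : x = y * iota t by rewrite /y -mulgA -iotaM mulVg iota1 mulg1.
rewrite xE [X in _ <> ghead u X]x_E => hne.
have Dy : D u y.
  have [//|E1] := red (t * g); have [//|E2] := red t.
  by case: hne; rewrite E1 E2.
move: hne; rewrite !(headDM _ Dy).
have [vu _|vu] := eqVneq v u; last by rewrite !head_iota_neq.
rewrite -vu in Dy *; split=> //; rewrite x_E; apply: parM;
  last by apply: par_iota; apply: star_refl.
exact: parDS.
Qed.

(* Two walls S_u and b S_v that do not cross: all the sectors of b S_v but the
   one that contains S_u are contained in a single sector of S_u. *)
Lemma head_nested u v (b : W) :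
  (star u v /\ exists s t, [/\ S u s, S v t & b = s * t]) \/
  forall x, ghead v x <> ghead v b^-1 -> ghead u (b * x) = ghead u b.
Proof.
have [s [t [y [Ss St bE hy hy']]]] := double_coset (star u) (star v) b.
have SVM z : ghead v (t * z) = ghead v t * ghead v z by apply: headSM.
have hbV z : ghead v (t * z) = 1 -> ghead v z = (ghead v t)^-1.
  by rewrite SVM => /(congr1 ( *%g (ghead v t)^-1)); rewrite mulKg mulg1.
have [y1|/eqP y1] := eqVneq y 1.
  rewrite {}y1 mulg1 in bE.
  have [uv|uv] := boolP (star u v); first by left; split=> //; exists s, t.
  right=> x hx; rewrite bE -mulgA !(headSM _ Ss); congr (_ * _).
  have vu : ~~ star v u by rewrite star_sym.
  rewrite (par_head St vu); apply: (head_nstar vu) => htx; apply: hx.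
  rewrite (hbV x) // bE invMg headSM; last exact: parV.
  by rewrite headSV // (par_head (parV Ss) uv) mulg1.
have nDu : ~ D u y.
  by move=> Dy; apply: y1; apply: (par_heads (parDS Dy)).
have nDv : ~ D v y^-1.
  move=> Dy; apply: y1; rewrite -[y]invgK (par_heads (parDS Dy)) ?invg1 //.
right=> x hx; rewrite bE -!mulgA !(headSM _ Ss); congr (_ * _).
have hbE : ghead v b^-1 = (ghead v t)^-1.
  rewrite bE !invMg headSM; last exact: parV.
  rewrite headSV //; case: (@head_reducedM v y^-1 s^-1) => [w|//|->].
    rewrite invgK; have [uw|uw] := boolP (star u w); first by left; apply: hy.
    by right; apply: (par_head (parV Ss)).
  by rewrite hy' ?star_refl // mulg1.
have htx : ghead v (t * x) <> 1 by move=> /hbV E; apply: hx; rewrite E hbE.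
(* [y] has no last syllable in the star of [v], so its product with such a [z] is reduced and the
   head at [u] does not depend on [z]. *)
have red z : (forall w, ~~ star v w -> ghead w z = 1) ->
  ghead u (y * z) = ghead u y.
  move=> hz; case: (@head_reducedM u y z) => // w.
  have [vw|vw] := boolP (star v w); first by left; apply: hy'.
  by right; apply: hz.
rewrite !red // => w vw; first exact: (par_head St vw).
exact: (head_nstar vw).
Qed.

(** Here [x] stabilizes the walls [S v] and [c S v]. With [y] the reduced middle part of [c] and [j]
    one of its heads, [z = x ^ s] satisfies [z y = y e], both products being reduced. If [z] were
    not in [D j], the head at [j] would be trivial on the left but not on the right. *)
Lemma fix_two_walls v c : ~ S v c -> exists s j,
  [/\ S v s, ~~ star v j & forall x, S v x -> S v (x ^ c) ->
    S v (x ^ s) /\ D j (x ^ s)].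
Proof.
move=> nSc; have [s [t [y [Ss St cE hy hy']]]] :=
  double_coset (star v) (star v) c.
have y1 : y <> 1.
  by move=> y1; apply: nSc; rewrite cE y1 mulg1; apply: parM.
have [j hj] := head_ex y1.
have nvj : ~~ star v j by apply/negP => /hy.
exists s, j; split=> // x Sx; rewrite !conjgE !mulgA => Sxc;
  set z := s^-1 * x * s.
have Sz : S v z by apply: parM => //; apply: parM => //; apply: parV.
split=> //; pose e := t * (c^-1 * x * c) * t^-1.
have Se : S v e by apply: parM; [apply: parM | apply: parV].
have zy : z * y = y * e.
  by rewrite /z /e cE !invMg !mulgA !mulgK mulgV mul1g.
have [w|Dy|E] := @head_reducedM j y e.
- have [vw|vw] := boolP (star v w); first by left; apply: hy'.
  by right; apply: (par_head Se).
- by case: hj; rewrite (par_head Dy) // adj_irr.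
have [w|//|E'] := @head_reducedM j z y.
  have [vw|vw] := boolP (star v w); first by right; apply: hy.
  by left; apply: (par_head (parV Sz)).
by case: hj; rewrite -E -zy E' (par_head Sz).
Qed.

(** A rotation about the wall [y S l] that stabilizes [S m] forces the two walls to cross or to have
    the same type and coincide. The proof compares heads in [k z = z h], where [z] is the reduced
    middle part of [y]. *)
Lemma conj_in_star m l (g : G l) (y : W) : g <> 1 -> S m (iota g ^ y^-1) ->
  star m l /\ exists s t, [/\ S m s, S l t & y = s * t].
Proof.
rewrite conjgE invgK mulgA => g1 Sy;
  have [s [t [z [Ss St yE hz hz']]]] := double_coset (star m) (star l) y.
pose h := ghead l t * g * (ghead l t)^-1.
have h1 : h <> 1.
  move=> h1; apply: g1; apply: (mulgI (ghead l t));
    apply: (mulIg (ghead l t)^-1).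
  by rewrite -/h h1 mulg1 mulgV.
pose k := z * iota h * z^-1.
have Sk : S m k.
  suff -> : k = s^-1 * (y * iota g * y^-1) * s.
    by apply: parM => //; apply: parM => //; apply: parV.
  by rewrite /k /h -S_iota // yE !invMg !mulgA mulVg mul1g mulgKV.
have k1 : k <> 1.
  move=> /(congr1 (fun x => z^-1 * x * z));
    rewrite /k mulg1 mulVg !mulgA mulVg mul1g.
  by rewrite mulgKV => /(congr1 (ghead l)); rewrite head_iota head1.
have [i hi] := head_ex k1; have [mi _] := par_strip Sk hi.
have kz : k * z = z * iota h by rewrite /k mulgKV.
have [w|Dk|E] := @head_reducedM i k z.
- have [mw|mw] := boolP (star m w); first by right; apply: hz.
  by left; apply: (par_head (parV Sk)).
- by case: hi; rewrite (par_head Dk) // adj_irr.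
have [w|Dz|E'] := @head_reducedM i z (iota h).
- have [lw|lw] := eqVneq l w; first by left; apply: hz'; rewrite lw star_refl.
  by right; apply: head_iota_neq.
- have il : i = l.
    apply: contrapT => /eqP il; case: hi.
    by rewrite -E kz headDM // head_iota_neq // eq_sym.
  rewrite -il; split=> //; exists s, t; rewrite il; split=> //.
  suff z1 : z = 1 by rewrite yE z1 mulg1.
  rewrite -[z]invgK (par_heads (parV Dz)) ?invg1 // => w iw; apply: hz'.
  by rewrite -il /star iw orbT.
- by case: hi; rewrite -E kz E' hz.
Qed.

(** * Centralizers of elements outside the star subgroups *)

Lemma wall_nested v (b x : W) : ~ S v b -> ghead v x <> ghead v b^-1 ->
  ghead v (b * x) = ghead v b.
Proof.
move=> nSb; case: (head_nested v v b) => [[_ [s [t [Ss St bE]]]]|]; last exact.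
by case: nSb; rewrite bE; apply: parM.
Qed.

Definition star_elliptic (a : W) : Prop := exists v x, S v (a ^ x).

(** If [a] both starts and ends with a syllable of [G v], conjugating by the first one merges the
    two and shortens [a]. *)
Lemma cyclically_reduced (a : W) : a <> 1 -> ~ star_elliptic a ->
  exists x v, ghead v (a ^ x) <> 1 /\ ghead v (a ^ x)^-1 = 1.
Proof.
have [n] := ubnP (len a); elim: n => // n IH in a *; rewrite ltnS => la a1 na.
have [v hv] := head_ex a1.
have [h1|/eqP h1] := eqVneq (ghead v a^-1) 1.
  by exists 1, v; rewrite conjg1.
have nSa : ~ S v a by move=> Sa; apply: na; exists v, 1; rewrite conjg1.
set g := ghead v a in hv; set h := ghead v a^-1 in h1.
pose c : W := iota g^-1 * a.
have lc : len c < len a by apply: len_strip.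
(* As [a] is not in [S v], removing its first syllable at [v] leaves the last one unchanged. *)
have hc : ghead v c^-1 = h.
  rewrite invMg -iotaV invgK; apply: contrapT => /head_edge[_ Sa].
  by apply: nSa; rewrite -[a]invgK; apply: parV.
have aE : a ^ iota g = c * iota g by rewrite conjgE mulgA -iotaV.
have lag : len (a ^ iota g) < n.
  apply: leq_trans la; apply: leq_ltn_trans lc.
  rewrite aE -lenV invMg -iotaV.
  have -> : iota g^-1 * c^-1 = iota (g^-1 * h) * (iota h^-1 * c^-1) :> W.
    by rewrite mulgA -iotaM mulgK.
  apply: leq_trans (len_iotaM _ _) _; rewrite -[len c]lenV -hc.
  by apply: len_strip; rewrite hc.
have [||x [u [h2 h3]]] := IH _ lag.
- by move=> /eqP; rewrite conjg_eq1 => /eqP.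
- by move=> [u [x Su]]; apply: na; exists u, (iota g * x); rewrite conjgM.
by exists (iota g * x), u; rewrite conjgM.
Qed.

Lemma pigeonhole (T : eqType) (L : seq T) (P : nat -> T -> Prop) :
    (forall n, exists2 x, x \in L & P n x) ->
  exists i j x, [/\ i < j, P i x & P j x].
Proof.
move=> PL; pose f n := s2val (cid2 (PL n)).
have fL n : f n \in L by exact: s2valP (cid2 (PL n)).
have fP n : P n (f n) by exact: s2valP' (cid2 (PL n)).
apply: contrapT => nex.
have finj : injective f.
  move=> i j fij; apply: contrapT => /eqP; rewrite neq_ltn => /orP[] ij;
    apply: nex.
    by exists i, j, (f i); rewrite {2}fij.
  by exists j, i, (f i); rewrite {1}fij.
have /(_ (map f (seq.iota 0 (size L).+1))) := @uniq_leq_size T _ L.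
rewrite map_inj_uniq // iota_uniq size_map size_iota ltnn => H.
by have : false by apply: H => // x /mapP[m _ ->].
Qed.

(** * Elements that translate half-spaces along an axis *)

Section Axis.
Variables (k : V) (a : W).
Hypotheses (ha : ghead k a <> 1) (haV : ghead k a^-1 = 1).

(* A half-space: one side of the wall S_k, with a Y strictly contained in Y. *)
Let Y (x : W) : bool := ghead k x != 1.

Let Y1 : ~~ Y 1. Proof. by rewrite /Y head1 negbK. Qed.

Let Ya : Y a. Proof. exact/eqP. Qed.

Let nSa : ~ S k a.
Proof. by move=> /headSV; rewrite haV => /eqP;
  rewrite eq_sym invg_eq1 => /eqP. Qed.

Let YM x : Y x -> Y (a * x).
Proof.
move=> /eqP Yx; rewrite /Y wall_nested ?haV //; exact: Ya.
Qed.

Let YX n x : Y x -> Y (a ^+ n * x).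
Proof. by move=> Yx; elim: n => [|n IH]; rewrite ?mul1g // expgS -mulgA YM. Qed.

Let YXV m n x : m <= n -> ~~ Y (a ^- m * x) -> ~~ Y (a ^- n * x).
Proof.
move=> mn; apply: contra => /(YX (n - m)); rewrite mulgA.
suff -> : a ^+ (n - m) * a ^- n = a ^- m by [].
by apply: (mulIg (a ^+ n)); rewrite mulgVK -{2}(subnKC mn) expgnDr mulKg.
Qed.

Let YXmono m n x : m <= n -> Y (a ^+ m * x) -> Y (a ^+ n * x).
Proof. by move=> mn /(YX (n - m)); rewrite mulgA -expgnDr subnK. Qed.

Let no_period n : (forall x, Y (a ^+ n.+1 * x) = Y x) -> False.
Proof.
move=> /(_ 1); rewrite (negbTE Y1) mulg1 expgSr => /negbT; rewrite YX //.
Qed.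

(** Only finitely many half-spaces [u Y] contain [q] but not [p]: a path from [p] to [q] must enter
    them, and each of its edges crosses a single wall. *)
Let separating_finite p q : exists L : seq W, forall u,
  ~~ Y (u^-1 * p) -> Y (u^-1 * q) ->
  exists2 v, v \in L & forall x, Y (u^-1 * x) = Y (v^-1 * x).
Proof.
rewrite -[q](mulVKg p); elim/gprod_ind: (p^-1 * q) => w.
elim: w p => [|[v g] w IH] p.
  by exists [::] => u; rewrite word_nil mulg1 => /negbTE ->.
have [L LP] := IH (p * iota g); exists (p :: L) => u.
rewrite word_cons /= 2!mulgA -!mulgA [p * _]mulgA => up uq.
have [Ypg|nYpg] := boolP (Y (u^-1 * (p * iota g))); last first.
  by have [v' v'L v'E] := LP u nYpg uq; exists v'; rewrite ?in_cons ?v'L ?orbT.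
exists p => [|x]; first exact: mem_head.
(* The edge from [p] to [p * iota g] enters [u Y]; hence its wall is the one bounding [u Y], and
   [u Y = p Y]. *)
have [_ Sup] : k = v /\ S v (u^-1 * p).
  by apply: (@head_edge _ _ g); rewrite -mulgA (eqP (negPn up)); apply/eqP.
have Dup : D k (u^-1 * p).
  apply: headS_D; last exact/eqP/negPn.
  have [-> //] : k = v /\ S v (u^-1 * p).
  by apply: (@head_edge _ _ g); rewrite -mulgA (eqP (negPn up)); apply/eqP.
by rewrite /Y -[in LHS](mulVKg p x) mulgA headDM.
Qed.

(** Otherwise all the half-spaces [a ^- n Y] separate [w] from [a]; two of them coincide, and a
    positive power of [a] preserves [Y]. *)
Let attract w : exists n, Y (a ^+ n * w).
Proof.
apply: contrapT => nY; have {}nY n : ~~ Y (a ^+ n * w).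
  by apply/negP => Yn; apply: nY; exists n.
have [L LP] := separating_finite w a.
have [|i [j [v [ij Ei Ej]]]] := @pigeonhole _ L
  (fun n v => forall x, Y (a ^+ n * x) = Y (v^-1 * x)).
  move=> n; have := LP (a ^- n); rewrite invgK => /(_ (nY n) (YX n Ya)).
  by case=> v vL vE; exists v.
apply: (@no_period (j - i).-1) => x; rewrite prednK ?subn_gt0 //.
have <- : a ^+ j * (a ^- i * x) = a ^+ (j - i) * x.
  by rewrite -{1}(subnK (ltnW ij)) expgnDr -mulgA mulVKg.
by rewrite Ej -Ei mulVKg.
Qed.

Let repel w : exists n, ~~ Y (a ^- n * w).
Proof.
apply: contrapT => nY; have {}nY n : Y (a ^- n * w).
  by have [//|Yn] := boolP (Y (a ^- n * w)); case: nY; exists n.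
have [L LP] := separating_finite 1 w.
have [|i [j [v [ij Ei Ej]]]] := @pigeonhole _ L
  (fun n v => forall x, Y (a ^- n * x) = Y (v^-1 * x)).
  move=> n; apply: LP (nY n).
  by apply: (@YXV 0); rewrite // invg1 mul1g.
apply: (@no_period (j - i).-1) => x; rewrite prednK ?subn_gt0 //.
have <- : a ^- i * (a ^+ j * x) = a ^+ (j - i) * x.
  by rewrite -{1}(subnKC (ltnW ij)) expgnDr -mulgA mulKg.
by rewrite Ei -Ej mulKg.
Qed.

(** Of the four relative positions of [Y] and [u Y], disjointness is excluded by a large positive
    power of [a], which lies in both, and covering by a large negative one, which lies in
    neither. *)
Let translates_nested u : commute u a ->
  (forall x, Y (u^-1 * x) -> Y x) \/ (forall x, Y x -> Y (u^-1 * x)).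
Proof.
move=> ua; have uaX n : u^-1 * a ^+ n = a ^+ n * u^-1.
  exact/commute_sym/commuteV/commute_sym/commuteX.
have uaV n : u^-1 * a ^- n = a ^- n * u^-1.
  by apply: commuteV; exact: uaX.
have meet : exists z, Y z && Y (u^-1 * z).
  have [m Ym] := attract 1; have [n Yn] := attract u^-1.
  exists (a ^+ (maxn m n)); rewrite uaX (YXmono (leq_maxr m n) Yn) andbT.
  by rewrite -[a ^+ _]mulg1 (YXmono (leq_maxl m n) Ym).
have comeet : exists z, ~~ Y z && ~~ Y (u^-1 * z).
  have [m Ym] := repel 1; have [n Yn] := repel u^-1.
  exists (a ^- (maxn m n)); rewrite uaV (YXV (leq_maxr m n) Yn) andbT.
  by rewrite -[a ^- _]mulg1 (YXV (leq_maxl m n) Ym).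
have no_cover : (forall x, ~~ Y x -> Y (u^-1 * x)) -> False.
  by move=> cov; have [z /andP[/cov ->]] := comeet.
have [Su|nSu] := pselect (S k u).
  have hE x : ghead k (u^-1 * x) = (ghead k u)^-1 * ghead k x.
    by rewrite headSM ?headSV //; apply: parV.
  have [h1|h1] := eqVneq (ghead k u) 1.
    by left=> x; rewrite /Y hE h1 invg1 mul1g.
  case: no_cover => x /negPn/eqP hx.
  by rewrite /Y hE hx mulg1 invg_eq1.
have nSuV : ~ S k u^-1 by move=> /parV; rewrite invgK.
have N x : ghead k x <> ghead k u -> ghead k (u^-1 * x) = ghead k u^-1.
  by move=> hx; apply: wall_nested => //; rewrite invgK.
have [e1|e1] := eqVneq (ghead k u) 1; have [h1|h1] := eqVneq (ghead k u^-1) 1.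
- have [z /andP[/eqP Yz]] := meet; rewrite /Y N ?h1 ?eqxx // e1 //.
- by right=> x /eqP Yx; rewrite /Y N // e1.
- left=> x; rewrite /Y; apply: contra => /eqP hx.
  by rewrite N ?h1 // hx; apply/eqP; rewrite eq_sym.
- case: no_cover => x /negPn/eqP hx; rewrite /Y N // hx.
  by apply/eqP; rewrite eq_sym.
Qed.

(** With [t = a ^- m * a ^+ n * u], an integer power of [a] times [u], this places [t Y] between
    [a Y] and [Y]. The exponent is one at which [t Y] becomes contained in [Y]: just before, [Y] is
    contained in the translate by nestedness. *)
Let window u : commute u a -> exists m n,
  ~~ Y ((a ^- m * a ^+ n * u)^-1) /\ Y ((a ^- m * a ^+ n * u)^-1 * (a * a)).
Proof.
move=> ua; have [m Ym] := attract u^-1; have [n Yn] := repel (u^-1 * a).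
pose t i : W := a ^- m * a ^+ i * u.
have tC i : commute (t i) a.
  apply/commute_sym; apply: commuteM; last exact: commute_sym.
  by apply: commuteM; [apply/commuteV/commuteX | apply: commuteX].
have tS i : t i.+1 = t i * a.
  by rewrite tC /t expgS !mulgA (commuteV (commuteX m (commute_refl a))).
pose Q i := forall x, Y ((t i)^-1 * x) -> Y x.
have nQ0 : ~ Q 0.
  move=> /(_ 1); rewrite (negbTE Y1) => H; suff : false by [].
  apply: H; rewrite /t expg0 !mulg1 invMg invgK.
  by rewrite -(commuteV (commute_sym (commuteX m ua))).
have [i [nQi Qi]] : exists i, ~ Q i /\ Q i.+1.
  apply: contrapT => nex; have nQ i : ~ Q i.
    by elim: i => // i nQi Qi; apply: nex; exists i.
  have := nQ (m + n); case: (translates_nested (tC (m + n))) => // H; case.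
  move: (H a Ya) Yn; rewrite /t expgnDr mulKg invMg.
  rewrite (commuteV (commute_sym (commuteV (commute_sym (commuteX n ua))))).
  by rewrite -mulgA => ->.
exists m, i.+1; rewrite -/(t i.+1); split.
  by apply: contra Y1 => H; apply: Qi; rewrite mulg1.
case: (translates_nested (tC i)) => // H.
have tVC : commute (t i)^-1 a by apply/commute_sym/commuteV/commute_sym.
by rewrite tS invMg -mulgA [_^-1 * (a * a)]mulgA tVC -mulgA mulKg H.
Qed.

(* The translates of Y by b ^+ i, moved by powers of a to lie between a Y and Y,
   are finitely many; so two of them coincide. *)
Lemma axis_stabilizer b : commute a b ->
  exists p q m, 0 < m /\ D k (a ^- p * a ^+ q * b ^+ m).
Proof.
move=> ab; have [L LP] := separating_finite 1 (a * a).
have [|i [j [v [ij [m1 [n1 Ei]] [m2 [n2 Ej]]]]]] := @pigeonhole _ L (fun i v =>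
  exists m n, forall x, Y ((a ^- m * a ^+ n * b ^+ i)^-1 * x) = Y (v^-1 * x)).
  move=> i; have [m [n [Y1' Y2]]] := window (commute_sym (commuteX i ab)).
  rewrite -[_^-1]mulg1 in Y1'; have [v vL vE] := LP _ Y1' Y2.
  by exists v => //; exists m, n.
(* [c] is the quotient of the two shifted powers of [b] that give the same half-space, so it
   preserves [Y]; negative exponents of [a] are kept apart because exponents are natural numbers. *)
pose t := a ^- m1 * a ^+ n1 * b ^+ i;
  pose c := a ^- (m2 + n1) * a ^+ (m1 + n2) * b ^+ (j - i).
have bE : b ^+ j = b ^+ i * b ^+ (j - i) by rewrite -expgnDr subnKC // ltnW.
have bC : commute (b ^+ i) (a ^- (m2 + n1) * a ^+ (m1 + n2)).
  have baX q : commute (b ^+ i) (a ^+ q) by apply/commuteX/commute_sym/commuteX.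
  by apply: commuteM => //; apply: commuteV.
have aE : a ^- m1 * a ^+ n1 * (a ^- (m2 + n1) * a ^+ (m1 + n2)) =
    a ^- m2 * a ^+ n2.
  have aC : commute (a ^+ m1) (a ^- m2) by apply/commuteV/commuteX2.
  rewrite !expgnDr invMg !mulgA mulgK -[in LHS](mulgA _ _ (a ^+ m1)) -aC.
  by rewrite mulKg.
have tc : t * c = a ^- m2 * a ^+ n2 * b ^+ j.
  rewrite /t /c bE -aE -[LHS]mulgA [b ^+ i * (_ * _)]mulgA bC.
  by rewrite !mulgA.
have Yc x : Y (c * x) = Y x.
  by rewrite -(mulKg t (c * x)) [t * _]mulgA tc Ei -Ej mulKg.
have c1 : ghead k c = 1 by apply/eqP/negPn; rewrite -/(Y c) -[c]mulg1 Yc.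
have cV1 : ghead k c^-1 = 1.
  by apply/eqP/negPn; rewrite -/(Y c^-1) -Yc mulgV.
exists (m2 + n1), (m1 + n2), (j - i); rewrite subn_gt0; split=> //.
(* Both [c] and its inverse have trivial head at [k]; if [c] moved the wall, it would send [a], a
   point of [Y], out of [Y]. *)
apply: headS_D => //; apply: contrapT => nSc.
have := Yc a; rewrite Ya /Y wall_nested ?cV1 // ?c1 ?eqxx //.
Qed.

Lemma axis_torsion_free n : a ^+ n.+1 <> 1.
Proof. by move=> an; apply: (@no_period n) => x; rewrite an mul1g. Qed.

End Axis.

Lemma loxodromic_commuting (a b : W) : a <> 1 -> ~ star_elliptic a ->
  commute a b -> exists x v p q m,
  0 < m /\ D v ((a ^- p * a ^+ q * b ^+ m) ^ x).
Proof.
move=> a1 na ab; have [x [v [hv hV]]] := cyclically_reduced a1 na.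
have abx : commute (a ^ x) (b ^ x) by rewrite /commute -!conjMg ab.
have [p [q [m [m0 Dm]]]] := axis_stabilizer hv hV abx.
by exists x, v, p, q, m; rewrite !conjMg conjVg !conjXg.
Qed.

Lemma loxodromic_torsion_free (a : W) n : a <> 1 -> ~ star_elliptic a ->
  a ^+ n.+1 <> 1.
Proof.
move=> a1 na an; have [x [v [hv hV]]] := cyclically_reduced a1 na.
by apply: (axis_torsion_free hv hV (n := n)); rewrite -conjXg an conj1g.
Qed.
End Heads.

(** * Automorphisms of cyclic products *)

Section CycleGraph.
Variable n : nat.
Hypothesis n5 : 5 <= n.

Import GRing.Theory.

(** The bound [5 <= n] enters the whole argument through this lemma. *)
Lemma Zn_neq k (i j : 'Z_n) : 0 < k < 5 -> (i - j = k%:R)%R -> i <> j.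
Proof.
move=> /andP[k0 k5] ij eij; move: ij; rewrite eij subrr => /(congr1 val) /=.
rewrite val_Zp_nat; last exact: leq_trans n5.
by rewrite modn_small ?(leq_trans k5) // => k0'; rewrite -k0' in k0.
Qed.

Lemma Zn_ind_up (P : 'Z_n -> Prop) i :
  P i -> (forall j, P j -> P (j + 1)%R) -> forall j, P j.
Proof.
move=> Pi PS j; suff H k : P (i + k%:R)%R.
  by have := H (j - i)%R; rewrite natr_Zp addrC subrK.
elim: k => [|k IH]; first by rewrite addr0.
by rewrite -natr1 addrA; apply: PS.
Qed.

Lemma Zn_ind_down (P : 'Z_n -> Prop) i :
  P i -> (forall j, P (j + 1)%R -> P j) -> forall j, P j.
Proof.
move=> Pi PS j; suff H k : P (i - k%:R)%R.
  by have := H (i - j)%R; rewrite natr_Zp opprB addrC subrK.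
elim: k => [|k IH]; first by rewrite subr0.
by apply: PS; rewrite -natr1 opprD addrA subrK.
Qed.

Local Notation adj := (@cycle_adj n).

Lemma cycle_adj_sym : symmetric adj.
Proof. by move=> i j; rewrite /cycle_adj orbC. Qed.

Lemma cycle_adj_irr : irreflexive adj.
Proof.
move=> i; rewrite /cycle_adj orbb; apply/eqP/nesym/(@Zn_neq 1) => //; ring.
Qed.

Lemma cycle_adjS (i : 'Z_n) : adj i (i + 1)%R.
Proof. by rewrite /cycle_adj eqxx. Qed.

Lemma cycle_adjP (i j : 'Z_n) : reflect (j = i + 1 \/ j = i - 1)%R (adj i j).
Proof.
apply: (iffP orP) => -[] => [/eqP ->|/eqP ->|->|->].
- by left.
- by right; rewrite addrK.
- by left.
- by right; rewrite subrK.
Qed.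

(* False for n = 4. *)
Lemma unique_common_neighbour (k j : 'Z_n) : ~~ star adj k j ->
  exists2 i, adj k i & forall l, adj k l -> adj j l -> l = i.
Proof.
rewrite negb_or => /andP[/eqP jk _].
have lj l : adj k l -> adj j l -> l = (k + 1)%R /\ j = (k + 2%:R)%R \/
    l = (k - 1)%R /\ j = (k - 2%:R)%R.
  move=> /cycle_adjP[] -> /cycle_adjP[] e.
  - by case: jk; apply: (addIr 1%R); rewrite -e.
  - by left; split=> //; apply: (addIr (-1)%R); rewrite -e; ring.
  - by right; split=> //; apply: (addIr 1%R); rewrite -e; ring.
  - by case: jk; apply: (addIr (-1)%R); rewrite -e.
have [j2|j2] := pselect (j = (k + 2%:R)%R).
  exists (k + 1)%R; first exact: cycle_adjS.
  move=> l kl /(lj l kl)[[]//|[_]]; rewrite j2 => /(@Zn_neq 4) -[] //; ring.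
exists (k - 1)%R; first by apply/cycle_adjP; right.
by move=> l kl /(lj l kl)[[_ /j2]|[]].
Qed.

End CycleGraph.

Lemma inj_surj_bij (T U : Type) (h : T -> U) :
  injective h -> (forall y, exists x, y = h x) -> bijective h.
Proof.
move=> h_inj h_surj; exists (fun y => sval (cid (h_surj y))) => [x|y].
  by apply: h_inj; rewrite -(svalP (cid (h_surj (h x)))).
by rewrite -(svalP (cid (h_surj y))).
Qed.

Section CyclicProduct.
Variable n : nat.
Hypothesis n5 : 5 <= n.
Variable G : 'Z_n -> groupType.
Hypothesis G_nontrivial : forall i, exists g : G i, g <> 1.

Local Notation adj := (@cycle_adj n).
Local Notation W := (graph_product adj G).
Local Notation iota := (gprod_in adj).
Local Notation star := (star adj).
Local Notation S v := (par (star v)).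
Local Notation D v := (par (adj v)).

Let adj_sym := @cycle_adj_sym n.
Let adj_irr := cycle_adj_irr n5.
Let head1 := @head1 _ _ G adj_sym adj_irr.
Let headM := @headM _ _ G adj_sym adj_irr.
Let headM_adj := @headM_adj _ _ G adj_sym adj_irr.
Let head_nstar := @head_nstar _ _ G adj_sym adj_irr.
Let head_iota := @head_iota _ _ G adj_sym adj_irr.
Let head_iota_neq := @head_iota_neq _ _ G adj_sym adj_irr.
Let head_ind := @head_ind _ _ G adj_sym adj_irr.
Let head_ex := @head_ex _ _ G adj_sym adj_irr.
Let par_head := @par_head _ _ G adj_sym adj_irr.
Let parI := @parI _ _ G adj_sym adj_irr.
Let headDM := @headDM _ _ G adj_sym adj_irr.
Let headSM := @headSM _ _ G adj_sym adj_irr.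
Let headSV := @headSV _ _ G adj_sym adj_irr.
Let headS_D := @headS_D _ _ G adj_sym adj_irr.
Let head_edge := @head_edge _ _ G adj_sym adj_irr.
Let head_nested := @head_nested _ _ G adj_sym adj_irr.
Let fix_two_walls := @fix_two_walls _ _ G adj_sym adj_irr.
Let conj_in_star := @conj_in_star _ _ G adj_sym adj_irr.
Let S_iota := @S_iota _ _ G adj_sym adj_irr.
Let D_comm := @D_comm _ _ G adj_sym.
Let loxodromic_commuting := @loxodromic_commuting _ _ G adj_sym adj_irr.
Let loxodromic_torsion_free := @loxodromic_torsion_free _ _ G adj_sym adj_irr.

Lemma par_pred1 i (x : W) : par (pred1 i) x -> exists g : G i, x = iota g.
Proof.
elim/par_ind=> [|j h y /eqP ji _ [g ->]]; first by exists 1; rewrite iota1.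
by subst j; exists (h * g); rewrite iotaM.
Qed.

Lemma iota_inj i : injective (@gprod_in _ adj G i).
Proof. by move=> g h E; rewrite -[g]head_iota E head_iota. Qed.

Lemma iota_eq1 i (g : G i) : iota g = 1 :> W -> g = 1.
Proof. by rewrite -(@iota1 _ adj G i); apply: iota_inj. Qed.

Lemma S_self k (g : G k) : S k (iota g : W).
Proof. by apply: par_iota; apply: star_refl. Qed.

Lemma iota_conjS k s (g : G k) : S k s ->
  (iota g : W) ^ s = iota ((ghead k s)^-1 * g * ghead k s).
Proof.
move=> Ss; rewrite conjgE mulgA -[X in _ * X](invgK s) S_iota; last exact: parV.
by rewrite headSV // invgK.
Qed.

(** The star of [k] and the link of [j] meet in at most one vertex, the common neighbour of [k] and
    [j], so the intersection of parabolics lies in one vertex group. *)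
Lemma fix_two_walls_cycle k c : ~ S k c -> exists s i,
  adj k i /\ forall x, S k x -> S k (x ^ c) -> exists g : G i, x ^ s = iota g.
Proof.
move=> /fix_two_walls[s [j [Ss kj Hs]]].
have [i ki uniq_i] := unique_common_neighbour n5 kj.
exists s, i; split=> // x Sx Sxc; have [Sxs Dxs] := Hs x Sx Sxc.
apply: par_pred1; apply: parS (parI Sxs Dxs) => l /andP[/orP[/eqP->|kl] jl].
  by move: kj; rewrite star_sym // /star jl orbT.
by rewrite /= (uniq_i l kl jl).
Qed.

(** Otherwise [x] stabilizes two walls of type [k] and is conjugate in [S k] to an element of some
    [D j] with [j] outside the star of [k], so that its head at [k] is trivial. *)
Lemma rotation_centralizer k (x c : W) :
  S k x -> ghead k x <> 1 -> commute x c -> S k c.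
Proof.
move=> Sx hx xc; apply: contrapT => nSc.
have [s [j [Ss kj Hs]]] := fix_two_walls nSc.
have [||Sxs Dxs] := Hs x; rewrite ?conjgE ?xc ?mulKg //.
apply: hx; have := par_head Dxs (_ : ~~ adj j k).
rewrite conjgE headSM; last exact: parV.
rewrite headSM // headSV // => H.
apply: (mulgI (ghead k s)^-1); apply: (mulIg (ghead k s)).
rewrite mulg1 mulVg -mulgA H //.
by apply: contra kj; rewrite star_sym // /star orbC => ->.
Qed.

(** Either the centralizer preserves the wall fixed by [a], or [a] fixes two walls; in the latter
    case it is conjugate into a vertex group, and its centralizer preserves the wall about which it
    rotates. *)
Lemma star_elliptic_centralizer (a : W) : a <> 1 -> star_elliptic a ->
  exists k x, forall c, commute a c -> S k (c ^ x).
Proof.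
move=> a1 [k [x Sa]];
  have [H|nH] := pselect (forall c, commute a c -> S k (c ^ x)).
  by exists k, x.
have [c [ac nSc]] : exists c, commute a c /\ ~ S k (c ^ x).
  apply: contrapT => nex; apply: nH => c ac; apply: contrapT => nS.
  by apply: nex; exists c.
have [s [i [ki Hs]]] := fix_two_walls_cycle nSc.
have cx (b : W) : commute a b -> (a ^ x) ^ (b ^ x) = a ^ x.
  by move=> ab; rewrite -conjJg [a ^ b]conjgE ab mulKg.
have [||g gE] := Hs (a ^ x); rewrite ?cx //.
exists i, (x * s) => d ad; apply: (@rotation_centralizer i (iota g)).
- exact: S_self.
- rewrite head_iota => g1; apply: a1; apply/eqP.
  by rewrite -(conjg_eq1 _ x) -(conjg_eq1 _ s) gE g1 iota1.
- by rewrite -gE -conjgM /commute -!conjMg ad.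
Qed.

Lemma iota_ncomm i j (g : G i) (h : G j) : ~~ star i j -> g <> 1 -> h <> 1 ->
  ~ commute (iota g : W) (iota h).
Proof.
move=> nij g1 h1 /(congr1 (ghead i)); rewrite headM.
have ji : ~~ star j i by rewrite star_sym.
have neq_ij : j != i by apply: contra nij => /eqP->; apply: star_refl.
rewrite head_iota_neq // mulg1 (head_nstar ji) //.
by rewrite headM head_iota_neq 1?eq_sym // mulg1.
Qed.

Lemma not_all_star k (x : W) : ~ forall y, S k (y ^ x).
Proof.
move=> H; have [g g1] := G_nontrivial (k + 2%:R)%R.
have := H (iota g ^ x^-1); rewrite -conjgM mulVg conjg1 => Sg.
apply: g1; rewrite -[g]head_iota; apply: (par_head Sg).
apply/negP => /orP[/eqP|/cycle_adjP[]]; apply/eqP.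
- by apply/eqP/(@Zn_neq _ n5 2) => //; ring.
- by apply/eqP/(@Zn_neq _ n5 1) => //; ring.
- by apply/eqP/(@Zn_neq _ n5 3) => //; ring.
Qed.

(** * Images of the vertex groups under an automorphism *)

Section Automorphism.
Variable phi : autgroup W.

Local Notation f g := (phi (iota g)).

Definition in_star k (x : W) i : Prop := forall g : G i, S k (f g ^ x).

Definition vertex_elliptic i : Prop :=
  exists m x, forall g : G i, exists h : G m, f g ^ x = iota h.

Lemma phi_inj : injective phi. Proof. exact/bij_inj/aut_bij. Qed.

Lemma phi_surj y : exists x, y = phi x.
Proof. by have [h _ hK] := aut_bij phi; exists (h y); rewrite hK. Qed.

Lemma phi1 : phi 1 = 1. Proof. exact: sd_aut1. Qed.

Lemma phiV x : phi x^-1 = (phi x)^-1.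
Proof. by apply: (mulgI (phi x)); rewrite -autgroupM !mulgV phi1. Qed.

Lemma phiX x m : phi (x ^+ m) = phi x ^+ m.
Proof. by elim: m => [|m IH]; rewrite ?phi1 // !expgS autgroupM IH. Qed.

Lemma f_neq1 i (g : G i) : g <> 1 -> f g <> 1.
Proof. by move=> g1; rewrite -phi1 => /phi_inj /iota_eq1. Qed.

Lemma f_comm i j (g : G i) (h : G j) : adj i j -> commute (f g) (f h).
Proof. by move=> ij; rewrite /commute -!autgroupM iotaC. Qed.

Lemma f_ncomm i j (g : G i) (h : G j) : ~~ star i j -> g <> 1 -> h <> 1 ->
  ~ commute (f g) (f h).
Proof.
move=> ij g1 h1; rewrite /commute -!autgroupM => /phi_inj.
exact: iota_ncomm.
Qed.

Lemma not_all_in_star k x : ~ forall i, in_star k x i.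
Proof.
move=> H; apply: (@not_all_star k x) => y; have [w ->] := phi_surj y.
elim/head_ind: w => [|i g w _ _ IH]; first by rewrite phi1 conj1g; apply: par1.
by rewrite autgroupM conjMg; apply: parM => //; apply: H.
Qed.

(** If [c] moved the wall, the group [phi(G i)] would fix both this wall and its translate by [c],
    and would be conjugate into a vertex group. *)
Lemma in_star_centralizer i k x c : ~ vertex_elliptic i -> in_star k x i ->
  (forall g : G i, commute (f g) c) -> S k (c ^ x).
Proof.
move=> nell Si ic; apply: contrapT => /fix_two_walls_cycle[s [j [_ Hs]]].
apply: nell; exists j, (x * s) => g; rewrite conjgM; apply: Hs; first exact: Si.
by rewrite -conjJg [f g ^ c]conjgE ic mulKg; apply: Si.
Qed.

Lemma in_star_adj i j k x : ~ vertex_elliptic i -> in_star k x i ->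
  adj i j -> in_star k x j.
Proof.
move=> nell Si ij h; apply: (in_star_centralizer nell Si) => g.
exact: f_comm.
Qed.

Lemma vertex_centralizer i m x (g : G i) h c : g <> 1 ->
  f g ^ x = iota (h : G m) ->
  commute (f g) c -> S m (c ^ x).
Proof.
move=> g1 gE gc; apply: (@rotation_centralizer m (iota h)); first exact: S_self.
  rewrite head_iota => h1; apply: (f_neq1 g1); apply/eqP.
  by rewrite -(conjg_eq1 _ x) gE h1 iota1.
by rewrite -gE /commute -!conjMg gc.
Qed.

Lemma ex_vertex_elliptic : exists i, vertex_elliptic i.
Proof.
apply: contrapT => nex; have {nex} nell i : ~ vertex_elliptic i.
  by move=> ell; apply: nex; exists i.
(* The centralizer of such an element contains [phi(G i)], and [in_star_adj] then spreads the star
   around the cycle. *)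
suff [i [j [g [ij g1 Eg]]]] : exists i j (g : G j),
    [/\ adj i j, g <> 1 & star_elliptic (f g)].
  have [k [x H]] := star_elliptic_centralizer (f_neq1 g1) Eg.
  apply: (@not_all_in_star k x); apply: (Zn_ind_up (i := i)) => [h|l Sl].
    by apply: H; apply: f_comm; rewrite adj_sym.
  exact: in_star_adj (nell l) Sl (cycle_adjS l).
have [g0 g01] := G_nontrivial 0%R; have [g1 g11] := G_nontrivial 1%R.
have a01 : adj (0 : 'Z_n)%R (1 : 'Z_n)%R by have := cycle_adjS (0 : 'Z_n)%R;
  rewrite GRing.add0r.
have [Eb|nEb] := pselect (star_elliptic (f g1)); first by exists 0%R, 1%R, g1.
have [Ea|nEa] := pselect (star_elliptic (f g0)).
  by exists 1%R, 0%R, g0; rewrite adj_sym.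
exfalso; set a := f g0 in nEa; set b := f g1 in nEb.
have ab : commute a b by apply: f_comm.
have a1 : a <> 1 by apply: f_neq1.
have [x [v [p [q [m [m0 Dm]]]]]] := loxodromic_commuting a1 nEa ab.
set c := a ^- p * a ^+ q * b ^+ m in Dm.
have ac : commute a c.
  apply: commuteM; last exact: commuteX.
  by apply: commuteM; [apply/commuteV/commuteX | apply: commuteX].
have iotaX i (g : G i) k : iota (g ^+ k) = iota g ^+ k :> W.
  by elim: k => [|k IH]; rewrite ?iota1 // !expgS iotaM IH.
(* The preimage of [c] has head [g1 ^+ m] at the vertex 1, nontrivial because [b] has infinite
   order. *)
have c1 : c <> 1.
  pose d0 := g0 ^- p * g0 ^+ q; pose d1 := g1 ^+ m.
  have -> : c = phi (iota d0 * iota d1).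
    by rewrite /d0 /d1 iotaM iotaV !iotaX !autgroupM phiV !phiX.
  rewrite -phi1 => /phi_inj /(congr1 (ghead 1%R)); rewrite headM_adj // head1.
  rewrite head_iota /d1 => g1m; apply: (@loxodromic_torsion_free b m.-1) => //.
    exact: f_neq1.
  by rewrite prednK // /b -phiX -iotaX g1m iota1 phi1.
(* [c] fixes a wall which [a] moves, and also its translate by [a]; so [c] is conjugate into a
   vertex group, and [a], commuting with it, lies in a conjugate of a star. *)
have nSa : ~ S v (a ^ x) by move=> Sa; apply: nEa; exists v, x.
have cax : (c ^ x) ^ (a ^ x) = c ^ x by rewrite -conjJg [c ^ a]conjgE -ac mulKg.
have [s [i [_ Hs]]] := fix_two_walls_cycle nSa.
have [||h hE] := Hs (c ^ x); rewrite ?cax; try exact: parDS.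
apply: nEa; exists i, (x * s); apply: (@rotation_centralizer i (iota h)).
- exact: S_self.
- rewrite head_iota => h1; apply: c1; apply/eqP.
  by rewrite -(conjg_eq1 _ x) -(conjg_eq1 _ s) hE h1 iota1.
- by rewrite -hE -conjgM /commute -!conjMg ac.
Qed.

Lemma all_vertex_elliptic i : vertex_elliptic i.
Proof.
have [j0 ell0] := ex_vertex_elliptic; apply: contrapT => nell_i.
(* Walking up the cycle from a non-elliptic vertex, there is a last one before an elliptic vertex.
   The wall of the latter then propagates downwards from [i]. *)
have [{nell_i} {}i [nell [m [x ell]]]] :
    exists i, ~ vertex_elliptic i /\ vertex_elliptic (i + 1)%R.
  apply: contrapT => nex; suff : ~ vertex_elliptic j0 by [].
  move: j0 {ell0}; apply: Zn_ind_up nell_i _ => j nellj ellj1.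
  by apply: nex; exists j.
have [h h1] := G_nontrivial (i + 1)%R; have [h' hE] := ell h.
have cen c : commute (f h) c -> S m (c ^ x) by apply: vertex_centralizer hE.
have Si : in_star m x i.
  by move=> g; apply: cen; apply: f_comm; rewrite adj_sym cycle_adjS.
have Si1 : in_star m x (i + 1)%R by move=> g; have [g' ->] := ell g;
  exact: S_self.
apply: (@not_all_in_star m x); apply: (Zn_ind_down Si) => j Sj.
have jj1 : adj (j + 1)%R j by rewrite adj_sym cycle_adjS.
have [ji|ji] := eqVneq (j + 1)%R i.
  by apply: in_star_adj nell Si _; rewrite -ji.
(* Near [i + 1], the vertex [j] is [i] or [i + 1], already treated. Farther away, [f g] does not
   commute with [f h], so it rotates the wall nontrivially and its centralizer preserves that
   wall. *)
have [/orP[/eqP|/cycle_adjP[]] ji1|ji1] := boolP (star (i + 1)%R (j + 1)%R).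
- by rewrite (GRing.addIr _ ji1).
- by rewrite (GRing.addIr _ ji1).
- by rewrite ji1 GRing.addrK eqxx in ji.
have [g g1] := G_nontrivial (j + 1)%R => k.
apply: (@rotation_centralizer m (f g ^ x)); first exact: Sj.
  move=> hg; apply: (f_ncomm ji1 h1 g1); apply/commute_sym.
  have := D_comm h' (headS_D (Sj g) hg); rewrite -hE -!conjMg.
  exact: conjg_inj.
by rewrite /commute -!conjMg f_comm.
Qed.

Lemma phiJ x z : phi (x ^ z) = phi x ^ phi z.
Proof. by rewrite !conjgE !autgroupM phiV. Qed.

Lemma D_conj k (d s : W) : D k d -> S k s -> D k (d ^ s).
Proof.
move=> Dd Ss; have Sd := parDS Dd; have SsV := parV Ss.
rewrite conjgE; apply: headS_D; first by do 2!apply: parM => //.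
by rewrite headSM // headDM // headSV // mulVg.
Qed.

Lemma D_iota k l (g : G l) : adj k l -> D k (iota g : W).
Proof. exact: par_iota. Qed.

(** * The walls rotated by the images of the vertex groups *)

Section Walls.
Variables (m : 'Z_n -> 'Z_n) (x : 'Z_n -> W) (theta : forall i, G i -> G (m i)).
Hypothesis thetaP : forall i (g : G i), f g ^ x i = iota (theta g).

(* The wall of the conjugate phi(G i) is x i * S (m i), with sectors indexed by
   G (m i): [sector i w] is the one that contains w. *)
Let sector i (w : W) : G (m i) := ghead (m i) ((x i)^-1 * w).

Let sectorM i (g : G i) w : sector i (f g * w) = theta g * sector i w.
Proof. by rewrite /sector -headM -thetaP conjgE -!mulgA mulVKg. Qed.

Let theta1 i : theta (1 : G i) = 1.
Proof. by apply: iota_eq1; rewrite -thetaP iota1 phi1 conj1g. Qed.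

Let theta_neq1 i (g : G i) : g <> 1 -> theta g <> 1.
Proof.
move=> g1 t1; apply: (f_neq1 g1); apply/eqP.
by rewrite -(conjg_eq1 _ (x i)) thetaP t1 iota1.
Qed.

Let same_wall i j := m i = m j /\ S (m i) ((x i)^-1 * x j).

Let same_sym i j : same_wall i j -> same_wall j i.
Proof. by move=> [mij /parV]; rewrite invMg invgK mij; split. Qed.

Let same_trans i j k : same_wall i j -> same_wall j k -> same_wall i k.
Proof.
move=> [mij Sij] [mjk Sjk]; split; first by rewrite mij.
by rewrite -[x k](mulVKg (x j)) mulgA; apply: parM => //; rewrite mij.
Qed.

Let conj_wall i j (h : G j) : f h ^ x i = iota (theta h) ^ ((x i)^-1 * x j)^-1.
Proof. by rewrite -thetaP -conjgM invMg invgK mulVKg. Qed.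

Let same_in_vertex i j (h : G j) : same_wall i j ->
  exists h' : G (m i), f h ^ x i = iota h'.
Proof.
move=> [mij]; rewrite conj_wall; move: (theta h); rewrite -mij => t /parV St.
by rewrite iota_conjS //; eexists.
Qed.

Let crossing_walls i j : star (m i) (m j) ->
    (exists s t, [/\ S (m i) s, S (m j) t & (x i)^-1 * x j = s * t]) ->
  same_wall i j \/ adj (m i) (m j) /\ forall h : G j, D (m i) (f h ^ x i).
Proof.
move=> /orP[/eqP mji|mij] [s [t [Ss St E]]].
  by left; split=> //; rewrite E; apply: parM => //; rewrite -mji.
right; split=> // h; rewrite conj_wall E invMg conjgM iota_conjS;
  last exact: parV.
by apply: D_conj; [apply: D_iota | apply: parV].
Qed.

(** [phi(G j)] commutes with a nontrivial rotation about the wall of [i], hence stabilizes that wall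
    while rotating about its own. *)
Let adjacent_walls i j : adj i j -> star (m i) (m j) /\
  exists s t, [/\ S (m i) s, S (m j) t & (x i)^-1 * x j = s * t].
Proof.
move=> ij; have [g g1] := G_nontrivial i; have [h h1] := G_nontrivial j.
apply: (conj_in_star (theta_neq1 h1)); rewrite -conj_wall.
by apply: (vertex_centralizer g1 (thetaP g)); apply: f_comm.
Qed.

Let ncomm_star i j : (forall h : G j, D (m i) (f h ^ x i)) -> star i j.
Proof.
move=> Dj; apply: contrapT => /negP nij.
have [g g1] := G_nontrivial i; have [h h1] := G_nontrivial j.
apply: (f_ncomm nij g1 h1); apply/commute_sym.
have := D_comm (theta g) (Dj h); rewrite -thetaP -!conjMg; exact: conjg_inj.
Qed.

Let same_wall_eq i j : same_wall i j -> i = j.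
Proof.
move=> Sij; apply: contrapT => ij.
have Sii : same_wall i i by split=> //; rewrite mulVg; apply: par1.
(* The wall of [t] crosses the common wall of [r] and [r'], so [phi(G t)] commutes with the
   rotations about it, in particular with [phi(G r')]. *)
have next r t : same_wall i r -> adj r t -> ~ same_wall i t ->
    forall r', same_wall i r' -> adj t r'.
  move=> Sir rt nSit r' Sir'; have [rt1 rt2] := adjacent_walls rt.
  case: (crossing_walls rt1 rt2) => [Srt|[_ Dt]].
    by case: nSit; apply: same_trans Srt.
  suff : star t r'.
    by case/orP=> // /eqP r't; case: nSit; rewrite -r't.
  apply: contrapT => /negP ntr'; have [g g1] := G_nontrivial r'.
  have [h h1] := G_nontrivial t; apply: (f_ncomm ntr' h1 g1).
  have [g' gE] := same_in_vertex g (same_trans (same_sym Sir) Sir').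
  have := D_comm g' (Dt h); rewrite -gE -!conjMg; exact: conjg_inj.
have [r [Sir nSir]] : exists r, same_wall i r /\ ~ same_wall i (r + 1)%R.
  apply: contrapT => nex; apply: (@not_all_in_star (m i) (x i)) => k g.
  have [|g' ->] := same_in_vertex (i := i) g; last exact: S_self.
  move: k {g}; apply: (Zn_ind_up Sii) => k Sik; apply: contrapT => nSik.
  by apply: nex; exists k.
(* The vertices sharing the wall of [i] are thus neighbours of [r + 1]. Since [i] and [j] differ,
   both [r] and [r + 2] occur, and then [r] would have to be adjacent to [r + 3]. *)
have Ir r' : same_wall i r' -> r' = (r + 1 + 1)%R \/ r' = r.
  move=> /(next r _ Sir (cycle_adjS r) nSir)/cycle_adjP[->|->]; first by left.
  by right; rewrite GRing.addrK.
have S2 : same_wall i (r + 1 + 1)%R.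
  case: (Ir i Sii) (Ir j Sij) => [<-//|ir] [<-//|jr].
  by case: ij; rewrite ir jr.
have nS3 : ~ same_wall i (r + 1 + 1 + 1)%R.
  move=> /Ir[]; first by apply: (@Zn_neq _ n5 1) => //; ring.
  by apply: (@Zn_neq _ n5 3) => //; ring.
have /cycle_adjP[] := next _ _ S2 (cycle_adjS _) nS3 _ Sir; apply/nesym.
  by apply: (@Zn_neq _ n5 4) => //; ring.
by apply: (@Zn_neq _ n5 2) => //; ring.
Qed.

Let adj_crossing i j : adj i j ->
  [/\ adj (m i) (m j), forall h : G j, D (m i) (f h ^ x i) &
    exists s t, [/\ S (m i) s, S (m j) t & (x i)^-1 * x j = s * t]].
Proof.
move=> ij; have [st E] := adjacent_walls ij.
case: (crossing_walls st E) => [/same_wall_eq e|[]//].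
by rewrite e adj_irr in ij.
Qed.

Let sectorM_adj i j (h : G j) w : adj i j -> sector i (f h * w) = sector i w.
Proof.
move=> /adj_crossing[_ Dj _]; rewrite /sector -[RHS](headDM _ (Dj h)).
by rewrite conjgE -!mulgA mulVKg.
Qed.

(** The walls of [i] and [j] neither cross nor coincide, so the sectors of [j] away from the wall of
    [i] all lie in one sector of [i]. *)
Let sector_nadj i j w : ~~ star i j ->
  sector j w <> sector j (x i) -> sector i w = sector i (x j).
Proof.
move=> nij hw; case: (head_nested (m i) (m j) ((x i)^-1 * x j)) => [[st E]|H].
  case: (crossing_walls st E) => [/same_wall_eq ij|[_ Dj]].
    by rewrite ij star_refl in nij.
  by rewrite (ncomm_star Dj) in nij.
have := H ((x j)^-1 * w); rewrite invMg invgK -mulgA mulVKg; exact.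
Qed.

Let rotate j (e : G (m j)) w : exists h : G j, sector j (f h * w) <> e.
Proof.
have [we|we] := pselect (sector j w = e); last by exists 1;
  rewrite sectorM theta1 mul1g.
have [h h1] := G_nontrivial j; exists h; rewrite sectorM we => E.
by apply: (theta_neq1 h1); apply: (mulIg e); rewrite mul1g.
Qed.

(* The sector of the i-th wall containing all the walls that do not cross it. *)
Let side i : G (m i) := sector i (x (i + 1 + 1)%R).

Let side_nadj i j : ~~ star i j -> sector i (x j) = side i.
Proof.
suff : star i j \/ sector i (x j) = side i by case=> // ->.
move: j; apply: (Zn_ind_up (i := i)) => [|j Pj]; first by left;
  apply: star_refl.
have [ij1|ij1] := boolP (star i (j + 1)%R); [by left | right].
have [ij|ij] := boolP (star i j).
  (* The star of [i] can only be left upwards from [i + 1], towards the vertex where [side i] is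
     read. *)
  case/orP: ij => [/eqP ji|/cycle_adjP[] ji].
  - by case/negP: ij1; rewrite ji /star cycle_adjS orbT.
  - by rewrite ji.
  - by case/negP: ij1; rewrite ji GRing.subrK star_refl.
case: Pj => [ij'|<-]; first by rewrite ij' in ij.
(* The walls of [j] and [j + 1] cross, so rotating about each in turn yields one point outside both
   sectors that face the wall of [i]. Its sector at [i] is that of [x j] and of [x (j + 1)]. *)
have [h hE] := rotate (sector j (x i)) 1.
have [h' h'E] := rotate (sector (j + 1)%R (x i)) (f h * 1).
have := sector_nadj ij1 h'E; rewrite (sector_nadj ij) => [->//|].
by rewrite sectorM_adj // cycle_adjS.
Qed.

Let base_point : exists y, forall i, sector i y = side i.
Proof.
pose i : 'Z_n := 0%R; pose i' : 'Z_n := (i + 1)%R.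
have ii' : adj i i' by apply: cycle_adjS.
have [mii' _ [s [t [Ss St stE]]]] := adj_crossing ii'.
(* The points [w g g'] surround the crossing of two adjacent walls: they realize every pair of
   sectors of these two, and no other wall of the family separates them. *)
pose w (g : G (m i)) (g' : G (m i')) : W := x i * s * iota g * iota g'.
have wE g g' : w g g' = x i' * t^-1 * iota g * iota g'.
  by rewrite /w -[x i'](mulVKg (x i)) stE !mulgA mulgK.
have neq_m : m i != m i' by apply: contraL mii' => /eqP ->; rewrite adj_irr.
have wi g g' : sector i (w g g') = ghead (m i) s * g.
  rewrite /sector /w -!mulgA mulKg headSM // headM.
  by rewrite head_iota_neq ?mulg1 // eq_sym.
have wi' g g' : sector i' (w g g') = ghead (m i') t^-1 * g'.
  by rewrite /sector wE -!mulgA mulKg headSM ?headM_adj ?head_iota //;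
    apply: parV.
have wj j g g' h h' : j != i -> j != i' ->
  sector j (w g g') = sector j (w h h').
  move=> ji ji'; suff E g1 g1' : sector j (w g1 g1') = sector j (x i * s).
    by rewrite !E.
  have -> : sector j (w g1 g1') = sector j (x i * s * iota g1).
    apply: contrapT; rewrite /sector /w mulgA => /head_edge[mj Sj].
    case/eqP: ji'; apply: same_wall_eq; split=> //; rewrite mj.
    have -> : (x j)^-1 * x i' = (x j)^-1 * (x i * s * iota g1) *
        ((iota g1)^-1 * t).
      by rewrite -[x i'](mulVKg (x i)) stE !mulgA mulgK.
    apply: parM => //; apply: parM => //; apply: parV; apply: par_iota.
    by rewrite star_sym // /star mii' orbT.
  apply: contrapT; rewrite /sector mulgA => /head_edge[mj Sj].
  case/eqP: ji; apply: same_wall_eq; split=> //; rewrite mj.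
  rewrite -[_ * x i](mulgK s); apply: parM; last exact: parV.
  by rewrite -mulgA.
have avoid k (a e : G k) : exists g, a * g <> e.
  have [ae|ae] := pselect (a = e); last by exists 1; rewrite mulg1.
  have [g g1] := G_nontrivial k; exists g => E; apply: g1.
  by apply: (mulgI a); rewrite E mulg1 ae.
have [g gE] := avoid _ (ghead (m i) s) (side i).
have [g' g'E] := avoid _ (ghead (m i') t^-1) (side i').
exists (w ((ghead (m i) s)^-1 * side i) ((ghead (m i') t^-1)^-1 * side i'))
  => j.
have [->|ji] := eqVneq j i; first by rewrite wi mulVKg.
have [->|ji'] := eqVneq j i'; first by rewrite wi' mulVKg.
(* The sector at [j] may be computed at a point outside [side i] and [side i']; if [j] is outside
   the star of [i] or of [i'], nestedness puts this point in [side j]. *)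
rewrite (wj j _ _ g g') //.
have [sji|sji] := boolP (star j i); last first.
  have sij : ~~ star i j by rewrite star_sym.
  by rewrite (sector_nadj sji) ?(side_nadj sji) // wi (side_nadj sij).
have [sji'|sji'] := boolP (star j i'); last first.
  have sij : ~~ star i' j by rewrite star_sym.
  by rewrite (sector_nadj sji') ?(side_nadj sji') // wi' (side_nadj sij).
(* The cycle has no triangle, so no third vertex is adjacent to both [i] and [i']. *)
exfalso; move: sji sji';
  rewrite /star eq_sym (negbTE ji) eq_sym (negbTE ji') /=.
rewrite [adj j i]adj_sym => /cycle_adjP[] je; first by rewrite je eqxx in ji'.
rewrite [adj j _]adj_sym => /cycle_adjP[]; rewrite je; apply/nesym.
  by apply: (@Zn_neq _ n5 3) => //; rewrite /i'; ring.
by rewrite /i' GRing.addrK; apply: (@Zn_neq _ n5 1) => //; ring.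
Qed.

(* Ping-pong: the sectors of phi w * y recover the heads of w. *)
Let sector_phi y : (forall i, sector i y = side i) ->
  forall w i, sector i (phi w * y) = theta (ghead i w) * side i.
Proof.
move=> hy; elim/head_ind=> [|v g w g1 hw IH] i.
  by rewrite phi1 mul1g head1 theta1 mul1g.
rewrite autgroupM -mulgA.
have Ev : sector v (f g * (phi w * y)) = theta g * side v.
  by rewrite sectorM IH hw theta1 mul1g.
have [<-|vi] := eqVneq v i; first by rewrite Ev headM hw mulg1.
have [avi|navi] := boolP (adj v i).
  by rewrite sectorM_adj 1?adj_sym // IH headM_adj.
(* A nontrivial [g] moves the point out of [side v], hence into [side i], in agreement with the head
   at [i] being hidden by [g]. *)
have niv : ~~ star i v by rewrite /star (negbTE vi) /= adj_sym.
have nvi : ~~ star v i by rewrite star_sym.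
rewrite (sector_nadj niv) ?side_nadj //.
  by rewrite (head_nstar nvi) ?theta1 ?mul1g // headM hw mulg1.
rewrite Ev => E; apply: (theta_neq1 g1); apply: (mulIg (side v)).
by rewrite E mul1g.
Qed.

Lemma walls_at_point : exists y (psi : forall i, G i -> G (m i)),
  [/\ injective m, forall i j, adj (m i) (m j) = adj i j,
    forall i (g : G i), f g ^ y = iota (psi i g) &
    forall i (h : G (m i)), exists g, h = psi i g].
Proof.
have [y hy] := base_point; have Ephi := sector_phi hy.
(* The step from [y] to [y * iota s] crosses only the wall of type [k] through [y], while ping-pong
   shows that it changes some sector [i]. So every wall through [y] belongs to the family; in
   particular [m] is onto, and injective by finiteness. *)
have near k : exists i, m i = k /\ S k ((x i)^-1 * y).
  have [s s1] := G_nontrivial k; have [w wE] := phi_surj (iota s ^ y^-1).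
  have w1 : w <> 1.
    move=> w1; apply: s1; apply: iota_eq1; apply/eqP.
    by rewrite -(conjg_eq1 _ y^-1) wE w1 phi1.
  have [i hi] := head_ex w1; exists i.
  apply: (@head_edge _ _ s);
    rewrite -mulgA -[ghead _ _]/(sector i (y * iota s)).
  have -> : y * iota s = phi w * y by rewrite -wE conjgE invgK mulgA mulgVK.
  rewrite Ephi -[X in _ <> X]/(sector i y) hy => E; apply: (theta_neq1 hi).
  by apply: (mulIg (side i)); rewrite E mul1g.
have m_inj : injective m.
  pose r k := sval (cid (near k)).
  have rK : cancel r m by move=> k; case: (svalP (cid (near k))).
  exact: can_inj (canF_sym rK).
have Sy i : S (m i) ((x i)^-1 * y).
  by have [i' [/m_inj -> ]] := near (m i).
have psiE i (g : G i) : f g ^ y = iota ((side i)^-1 * theta g * side i).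
  by rewrite -[y](mulVKg (x i)) conjgM thetaP iota_conjS // -hy.
exists y, (fun i g => (side i)^-1 * theta g * side i); split=> //.
- move=> i j; apply/idP/idP => [mij|/adj_crossing[]//].
  have [/orP[/eqP ji|//]|nij] := boolP (star i j).
    by rewrite ji adj_irr in mij.
  have [g g1] := G_nontrivial i; have [h h1] := G_nontrivial j.
  case: (f_ncomm nij g1 h1); apply: (@conjg_inj _ y).
  by rewrite !conjMg !psiE iotaC.
(* The preimage of [h] is the head at [i] of the element carrying [y] to [y * iota h], by the
   ping-pong formula. *)
- move=> i h; have [w wE] := phi_surj (iota h ^ y^-1).
  exists (ghead i w); rewrite -mulgA -Ephi -wE conjgE invgK mulgA mulgVK.
  by rewrite /sector mulgA headSM // head_iota -hy mulKg.
Qed.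

End Walls.

Lemma aut_normal_form : exists (y : W) (s : {perm 'Z_n}),
  (forall i j, adj (s i) (s j) = adj i j) /\
  forall i, exists psi : G i -> G (s i), [/\ bijective psi,
    {morph psi : g h / g * h} & forall g, f g ^ y = iota (psi g)].
Proof.
pose m i := sval (cid (all_vertex_elliptic i)).
have mP i : exists x, forall g : G i, exists h : G (m i), f g ^ x = iota h.
  exact: svalP (cid (all_vertex_elliptic i)).
pose x i := sval (cid (mP i)).
have xP i (g : G i) : exists h : G (m i), f g ^ x i = iota h.
  exact: svalP (cid (mP i)) g.
have [y [psi [m_inj m_adj psiE psi_surj]]] :=
  walls_at_point (fun i g => svalP (cid (xP i g))).
exists y, (perm m_inj); split=> [i j|i]; first by rewrite !permE.
rewrite permE; exists (psi i); split=> [|g h|]; last exact: psiE.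
  apply: inj_surj_bij (psi_surj i) => g h E.
  by apply/iota_inj/phi_inj/(@conjg_inj _ y); rewrite !psiE E.
by apply: iota_inj; rewrite -psiE !iotaM autgroupM conjMg !psiE.
Qed.

End Automorphism.

(** * Inner automorphisms and the semidirect decomposition *)

Lemma conj_subproof (x : W) :
  `[< bijective (conjg^~ x^-1) /\ {morph conjg^~ x^-1 : y z / y * z} >].
Proof.
apply/asboolP; split; last by move=> y z; apply: conjMg.
by exists (conjg^~ x); [apply: conjgKV | apply: conjgK].
Qed.

(** As [y ^ z] is [z^-1 * y * z], the inverse makes [inner] a homomorphism for composition. *)
Definition inner (x : W) : autgroup W := AutGroup (conj_subproof x).

Lemma head_in_all_stars (x : W) : (forall i, S i x) -> x = 1.
Proof.
move=> Sx; apply: contrapT => /head_ex[j hj].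
apply: hj; apply: (par_head (Sx (j + 2%:R)%R)); apply/negP.
case/orP=> [/eqP|/cycle_adjP[]].
- by apply/nesym/(@Zn_neq _ n5 2) => //; ring.
- by apply/nesym/(@Zn_neq _ n5 3) => //; ring.
- by apply/nesym/(@Zn_neq _ n5 1) => //; ring.
Qed.

(** The two walls coincide or cross; if they crossed, [g] would lie in [D i] and have trivial head
    at [i]. *)
Lemma conj_in_vertex i j (g : G i) (h : G j) (x : W) :
  g <> 1 -> iota h ^ x^-1 = iota g -> i = j /\ S i x.
Proof.
move=> g1 E; have h1 : h <> 1.
  by move=> h1; apply: g1; apply: iota_eq1; rewrite -E h1 iota1 conj1g.
have [|/orP[/eqP ji|ij] [s [t [Ss St xE]]]] := @conj_in_star i j h x h1.
- by rewrite E; apply: S_self.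
- by split=> //; rewrite xE; apply: parM; rewrite // -ji.
case: g1; rewrite -[g]head_iota; apply: (@par_head (adj i));
  last by rewrite adj_irr.
rewrite -E xE invMg conjgM iota_conjS; last exact: parV.
by apply: D_conj; [apply: D_iota | apply: parV].
Qed.

Variable theta : iso_system G.

(** Triviality of the kernel: every vertex group is mapped to itself, so [s] fixes each vertex and
    [x] lies in all the star subgroups, whose intersection is trivial. *)
Lemma inner_local_inj (x : W) (a : vertex_auts G) (s : cycle_sym G) :
    (forall y, local_act theta (a, s) y ^ x^-1 = y) ->
  [/\ x = 1, a = 1 & s = 1].
Proof.
move=> H; have E i (g : G i) :
    iota (a (s i) (theta i (s i) g)) ^ x^-1 = iota g.
  by rewrite -[RHS]H /= local_fun_in.
have si i : i = s i /\ S i x.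
  by have [g g1] := G_nontrivial i; apply: conj_in_vertex g1 (E i g).
have x1 : x = 1 by apply: head_in_all_stars => i; case: (si i).
have s1 : s = 1.
  by apply/val_inj/permP => i; rewrite perm1; case: (si i).
split=> //; apply/functional_extensionality_dep => i; apply: autgroup_ext => g.
have := E i g; rewrite x1 invg1 conjg1 s1.
by rewrite [(1 : cycle_sym G) i]perm1 iso_map_id => /iota_inj.
Qed.

Lemma inner_local_surj (phi : autgroup W) : exists x u,
  forall y, phi y = local_act theta u y ^ x^-1.
Proof.
have [x [s [s_adj psiP]]] := aut_normal_form phi.
have s_cycle : cycle_sym_pred G s.
  apply/asboolP; split=> // i; have [psi [psi_bij psiM _]] := psiP i.
  apply: isomorphic_sym.
  pose psi' : {multiplicative G i -> G (s i)} :=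
    HB.pack psi (isMultiplicative.Build (G i) (G (s i)) psi psiM).
  by exists psi'.
pose s' := CycleSym s_cycle.
(* The automorphism is [psi] composed with [theta j i] for [i] the preimage of [j]; quantifying over
   all [i] with [s i = j] avoids a cast between vertex groups. *)
have aP j : exists a : autgroup (G j), forall i, s i = j -> forall g : G i,
    phi (iota g) ^ x = iota (a (theta i j g)).
  rewrite -(permKV s j); set i := s^-1 j.
  have [psi [psi_bij psiM psiE]] := psiP i.
  have ij : isomorphic (G i) (G (s i)) := cycle_sym_iso s' i.
  have [bij_ji jiM] := iso_mapP theta (isomorphic_sym ij).
  have aP : `[< bijective (psi \o theta (s i) i) /\
                {morph psi \o theta (s i) i : y z / y * z} >].
    apply/asboolP; split; first exact: bij_comp.
    by move=> y z /=; rewrite jiM psiM.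
  exists (AutGroup aP) => i' /perm_inj -> g /=.
  by rewrite iso_mapK // psiE.
pose a : vertex_auts G := fun j => sval (cid (aP j)).
suff E y : phi y ^ x = local_act theta (a, s') y.
  by exists x, (a, s') => y; rewrite -E conjgK.
elim/head_ind: y => [|i g y _ _ IH]; first by rewrite phi1 conj1g sd_aut1.
rewrite !autgroupM conjMg IH; congr (_ * _).
rewrite /= local_fun_in; exact: (svalP (cid (aP (s' i)))) i erefl g.
Qed.

End CyclicProduct.

Theorem theoremA (n : nat) (hn : (5 <= n)%N) (G : 'Z_n -> groupType)
    (G_nontrivial : forall i : 'Z_n, exists g : G i, g <> 1%g)
    (theta : iso_system G) :
  isomorphic (autgroup (cyclic_product G)) (semidirect (local_act theta)).
Proof.
apply: isomorphic_sym.
pose F (v : semidirect (local_act theta)) : autgroup (cyclic_product G) :=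
  inner v.1 * local_act theta v.2.
(* An automorphism conjugates the inner automorphism of [y] to that of the image of [y], which is
   the twisted product. *)
have FM : {morph F : v w / v * w}.
  move=> [x u] [y v]; apply: autgroup_ext => z.
  rewrite -[LHS]/((local_act theta (u * v) z) ^ (x * local_act theta u y)^-1).
  rewrite -[RHS]/((local_act theta u (local_act theta v z ^ y^-1)) ^ x^-1).
  by rewrite phiJ phiV invMg conjgM local_actM.
have F_inj : injective F.
  have F1 v : F v = 1 -> v = 1.
    case: v => x [a s] /(congr1 (fun h : autgroup _ => h : _ -> _)) E.
    have [|-> -> ->//] := @inner_local_inj _ hn _ G_nontrivial theta x a s.
    by move=> y; apply: (congr1 (@^~ y) E).
  move=> v w E; apply: (mulIg w^-1); rewrite mulgV; apply: F1.
  by apply: (mulIg (F w)); rewrite -FM mulgVK mul1g.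
have F_surj phi : exists v, phi = F v.
  have [x [u E]] := inner_local_surj hn G_nontrivial theta phi.
  by exists (x, u); apply: autgroup_ext.
pose F' : {multiplicative semidirect (local_act theta) ->
  autgroup (cyclic_product G)} :=
  HB.pack F (isMultiplicative.Build _ _ F FM).
by exists F'; apply: inj_surj_bij.
Qed.
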